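(* Let $j\colon\mathbb V\hookrightarrow\mathbb P$ be the open embedding of $\mathbb V$ in its projective compactification and let $H_\infty=\mathbb P\setminus j(\mathbb V)$ be the hyperplane at infinity. The functor $j_!\colon \mathrm{D}^{\mathrm b}_{\mathrm{PL}}(\mathbf{k}_{\mathbb V})\to\mathrm{D}^{\mathrm b}_{\mathrm{PL}}(\mathbf{k}_{\mathbb P})$ is well-defined, is fully faithful, and its essential image consists of the objects $F$ such that $F|_{H_\infty}\simeq 0$.
   Context: $\mathbf k$ is a field, $\mathbb V$ a real finite-dimensional vector space, and $\mathrm{D}^{\mathrm b}(\mathbf{k}_X)$ is the bounded derived category of sheaves of $\mathbf k$-modules on $X$. Set $\mathbb W=\mathbb V\times\mathbb R$; the projective compactification of $\mathbb V$ is $\mathbb P=(\mathbb W\setminus\{0\})/\mathbb R^\times$, with $j(x)$ the class of $(x,1)$. Let $\pi\colon\mathbb W\setminus\{0\}\to\mathbb P$ be the projection and $\iota\colon\mathbb W\setminus\{0\}\hookrightarrow\mathbb W$ the embedding. A convex polyhedron in a real finite-dimensional vector space is the intersection of a finite family of open or closed affine half-spaces. An object $F\in \mathrm{D}^{\mathrm b}(\mathbf{k}_{\mathbb V})$ is PL if there exists a finite family $\{P_a\}_{a\in A}$ of convex polyhedra such that $\mathbb V=\bigcup_{a\in A}P_a$ and $F|_{P_a}$ is constant of finite rank for every $a$; $\mathrm{D}^{\mathrm b}_{\mathrm{PL}}(\mathbf{k}_{\mathbb V})$ is the full subcategory of PL objects (and similarly with $\mathbb W$). $\mathrm{D}^{\mathrm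 b}_{\mathbb{R}\mathrm{c}}(\mathbf{k}_{\mathbb P})$ is the full subcategory of $\mathrm{D}^{\mathrm b}(\mathbf{k}_{\mathbb P})$ of objects with $\mathbb R$-constructible cohomology, and $\mathrm{D}^{\mathrm b}_{\mathrm{PL}}(\mathbf{k}_{\mathbb P})$ is the full subcategory of $\mathrm{D}^{\mathrm b}_{\mathbb{R}\mathrm{c}}(\mathbf{k}_{\mathbb P})$ of objects $F$ such that $\iota_!\pi^{-1}F\in\mathrm{D}^{\mathrm b}_{\mathrm{PL}}(\mathbf{k}_{\mathbb W})$. *)

(* Defs.v *)
From HB Require Import structures.
From mathcomp Require Import all_boot all_order all_algebra.
From mathcomp Require Import all_classical all_reals all_analysis.

Set Implicit Arguments.
Unset Strict Implicit.
Unset Printing Implicit Defensive.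

Import Order.TTheory GRing.Theory Num.Theory numFieldNormedType.Exports.
Import Quotient.

Local Open Scope classical_set_scope.
Local Open Scope ring_scope.
Local Open Scope quotient_scope.

(** The morphisms from [x] to [y] are the classes of elements of [hom x y]
    modulo [heq]. *)

Record category := Category {
  ob :> Type;
  hom : ob -> ob -> Type;
  heq : forall x y, hom x y -> hom x y -> Prop;
  idm : forall x, hom x x;
  comp : forall x y z, hom y z -> hom x y -> hom x z;
  heq_refl : forall x y (f : hom x y), heq f f;
  heq_sym : forall x y (f g : hom x y), heq f g -> heq g f;
  heq_trans : forall x y (f g h : hom x y), heq f g -> heq g h -> heq f h;
  comp_heq : forall x y z (g g' : hom y z) (f f' : hom x y),
    heq g g' -> heq f f' -> heq (comp g f) (comp g' f');
  compA : forall x y z t (h : hom z t) (g : hom y z) (f : hom x y),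
    heq (comp h (comp g f)) (comp (comp h g) f);
  comp1m : forall x y (f : hom x y), heq (comp (idm y) f) f;
  compm1 : forall x y (f : hom x y), heq (comp f (idm x)) f }.

Arguments hom {c} x y.
Arguments heq {c x y} f g.
Arguments idm {c} x.
Arguments comp {c x y z} g f.

Definition is_iso (C : category) (x y : C) (f : hom x y) : Prop :=
  exists g : hom y x, heq (comp g f) (idm x) /\ heq (comp f g) (idm y).

Definition isomorphic (C : category) (x y : C) : Prop :=
  exists f : hom x y, is_iso f.

Record functor (C D : category) := Functor {
  fob :> C -> D;
  fhom : forall x y, hom x y -> hom (fob x) (fob y);
  fhom_heq : forall x y (f g : hom x y), heq f g -> heq (fhom f) (fhom g);
  fhom_id : forall x, heq (fhom (idm x)) (idm (fob x));
  fhom_comp : forall x y z (g : hom y z) (f : hom x y),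
    heq (fhom (comp g f)) (comp (fhom g) (fhom f)) }.

Arguments fhom {C D} f {x y} _ : rename.

Definition fully_faithful (C D : category) (T : functor C D) : Prop :=
  (forall (x y : C) (f g : hom x y), heq (fhom T f) (fhom T g) -> heq f g) /\
  (forall (x y : C) (h : hom (T x) (T y)), exists f : hom x y, heq (fhom T f) h).

Definition essential_image (C D : category) (T : functor C D) (y : D) : Prop :=
  exists x : C, isomorphic (T x) y.

Section FullSubcategory.
Variables (C : category) (P : C -> Prop).

Definition full_subcategory : category := {|
  ob := {x : C | P x};
  hom := fun x y => hom (sval x) (sval y);
  heq := fun x y => @heq C (sval x) (sval y);
  idm := fun x => idm (sval x);
  comp := fun x y z => @comp C (sval x) (sval y) (sval z);
  heq_refl := fun x y => @heq_refl C (sval x) (sval y);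
  heq_sym := fun x y => @heq_sym C (sval x) (sval y);
  heq_trans := fun x y => @heq_trans C (sval x) (sval y);
  comp_heq := fun x y z => @comp_heq C (sval x) (sval y) (sval z);
  compA := fun x y z t => @compA C (sval x) (sval y) (sval z) (sval t);
  comp1m := fun x y => @comp1m C (sval x) (sval y);
  compm1 := fun x y => @compm1 C (sval x) (sval y) |}.

End FullSubcategory.

Section RestrictFunctor.
Variables (C D : category) (P : C -> Prop) (Q : D -> Prop) (T : functor C D).
Hypothesis PQ : forall x, P x -> Q (T x).

Definition restrict_functor :
    functor (full_subcategory P) (full_subcategory Q) :=
  @Functor (full_subcategory P) (full_subcategory Q)
    (fun x => exist Q (T (sval x)) (PQ (svalP x)))
    (fun x y f => fhom T f)
    (fun x y f g => @fhom_heq C D T _ _ f g)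
    (fun x => fhom_id T (sval x))
    (fun x y z g f => fhom_comp T g f).

End RestrictFunctor.

(** The localization [C[S^-1]]: morphisms are words in the morphisms of [C] and
    formal inverses of those of [S], modulo the congruence generated by the
    relations that make [C -> C[S^-1]] a functor inverting [S]. *)
Section Localization.
Variables (C : category) (S : forall x y : C, hom x y -> Prop).

Inductive word : C -> C -> Type :=
| WMap x y : hom x y -> word x y
| WInv x y (s : hom x y) : S s -> word y x
| WComp x y z : word y z -> word x y -> word x z.

Inductive word_eq : forall x y, word x y -> word x y -> Prop :=
| WE_refl x y (f : word x y) : word_eq f f
| WE_sym x y (f g : word x y) : word_eq f g -> word_eq g f
| WE_trans x y (f g h : word x y) : word_eq f g -> word_eq g h -> word_eq f h
| WE_comp x y z (g g' : word y z) (f f' : word x y) :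
    word_eq g g' -> word_eq f f' -> word_eq (WComp g f) (WComp g' f')
| WE_assoc x y z t (h : word z t) (g : word y z) (f : word x y) :
    word_eq (WComp h (WComp g f)) (WComp (WComp h g) f)
| WE_1m x y (f : word x y) : word_eq (WComp (WMap (idm y)) f) f
| WE_m1 x y (f : word x y) : word_eq (WComp f (WMap (idm x))) f
| WE_map x y (f g : hom x y) : heq f g -> word_eq (WMap f) (WMap g)
| WE_map_comp x y z (g : hom y z) (f : hom x y) :
    word_eq (WMap (comp g f)) (WComp (WMap g) (WMap f))
| WE_invl x y (s : hom x y) (Ss : S s) :
    word_eq (WComp (WInv Ss) (WMap s)) (WMap (idm x))
| WE_invr x y (s : hom x y) (Ss : S s) :
    word_eq (WComp (WMap s) (WInv Ss)) (WMap (idm y)).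

Definition localization : category := {|
  ob := C;
  hom := word;
  heq := word_eq;
  idm := fun x => WMap (idm x);
  comp := WComp;
  heq_refl := WE_refl;
  heq_sym := WE_sym;
  heq_trans := WE_trans;
  comp_heq := WE_comp;
  compA := WE_assoc;
  comp1m := WE_1m;
  compm1 := WE_m1 |}.

End Localization.

Section LocalizeFunctor.
Variables (C D : category) (T : functor C D).
Variables (S : forall x y : C, hom x y -> Prop).
Variables (S' : forall x y : D, hom x y -> Prop).
Hypothesis TS : forall x y (s : hom x y), S s -> S' (fhom T s).

Fixpoint map_word x y (w : word S x y) : word S' (T x) (T y) :=
  match w in word _ x y return word S' (T x) (T y) with
  | WMap _ _ f => WMap _ (fhom T f)
  | WInv _ _ _ Ss => WInv (TS Ss)
  | WComp _ _ _ g f => WComp (map_word g) (map_word f)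
  end.

Lemma map_word_eq x y (v w : word S x y) :
  word_eq v w -> word_eq (map_word v) (map_word w).
Proof.
elim=> {x y v w} /=.
- by move=> *; exact: WE_refl.
- by move=> *; exact: WE_sym.
- by move=> x y f g h _ fg _ gh; exact: WE_trans fg gh.
- by move=> *; exact: WE_comp.
- by move=> *; exact: WE_assoc.
- move=> x y f; apply: WE_trans (WE_1m _).
  by apply: WE_comp (WE_refl _); apply: WE_map; exact: fhom_id.
- move=> x y f; apply: WE_trans (WE_m1 _).
  by apply: WE_comp (WE_refl _) _; apply: WE_map; exact: fhom_id.
- by move=> x y f g fg; apply: WE_map; exact: fhom_heq.
- move=> x y z g f; apply: WE_trans (WE_map_comp _ _ _).
  by apply: WE_map; exact: fhom_comp.
- move=> x y s Ss; apply: WE_trans (WE_invl _) _.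
  by apply: WE_map; apply: heq_sym; exact: fhom_id.
- move=> x y s Ss; apply: WE_trans (WE_invr _) _.
  by apply: WE_map; apply: heq_sym; exact: fhom_id.
Qed.

Definition localize_functor : functor (localization S) (localization S') :=
  @Functor (localization S) (localization S') T map_word map_word_eq
    (fun x => WE_map S' (fhom_id T x))
    (fun x y z g f => WE_refl (WComp (map_word g) (map_word f))).

End LocalizeFunctor.

Definition finite_dimensional (K : fieldType) (M : lmodType K) : Prop :=
  exists (n : nat) (f : {linear M -> 'rV[K]_n}), bijective f.

(** [Ker d / Im d'] for linear maps [d' : L -> M] and [d : M -> N]. *)
Section CohomologyModule.
Variables (k : fieldType) (L M N : lmodType k).
Variables (d' : {linear L -> M}) (d : {linear M -> N}).

Definition cocycle_pred : {pred M} := [pred z | d z == 0].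

Lemma cocycle_submod : submod_closed cocycle_pred.
Proof.
split=> [|a u v]; rewrite !inE ?linear0 // => /eqP du /eqP dv.
by rewrite linearP du dv scaler0 addr0.
Qed.

HB.instance Definition _ :=
  GRing.isSubmodClosed.Build k M cocycle_pred cocycle_submod.

Definition cocycle : Type := {z : M | z \in cocycle_pred}.
HB.instance Definition _ := SubChoice.on cocycle.
HB.instance Definition _ := [SubChoice_isSubLmodule of cocycle by <:].

Definition boundary_pred : {pred cocycle} :=
  fun z => `[< exists w, val z = d' w >].

Lemma boundary_zmod : zmod_closed boundary_pred.
Proof.
split=> [|z z' /asboolP[w zw] /asboolP[w' zw']]; apply/asboolP.
  by exists 0; rewrite !linear0.
by exists (w - w'); rewrite !raddfB /= zw zw'.
Qed.

HB.instance Definition _ :=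
  GRing.isZmodClosed.Build cocycle boundary_pred boundary_zmod.

Definition cohomology_mod : Type := {quot boundary_pred}.
HB.instance Definition _ := GRing.Zmodule.on cohomology_mod.

Definition cohomology_class (z : cocycle) : cohomology_mod :=
  \pi_{quot boundary_pred} z.

Definition cohomology_repr (c : cohomology_mod) : cocycle :=
  repr (c : {quot boundary_pred}).

Lemma cohomology_reprK : cancel cohomology_repr cohomology_class.
Proof. exact: reprK. Qed.

Lemma cohomology_class_eq (z z' : cocycle) :
  cohomology_class z = cohomology_class z' <-> exists w, val z - val z' = d' w.
Proof.
have -> : (exists w, val z - val z' = d' w) <-> z - z' \in boundary_pred.
  by split=> [[w ww]|/asboolP[w ww]]; [apply/asboolP|]; exists w;
    move: ww; rewrite raddfB.
by rewrite idealrBE; split=> [zz'|/eqP]; first exact/eqP.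
Qed.

Lemma cohomology_class_zmod : {morph cohomology_class : x y / x + y >-> x + y}.
Proof. by move=> x y; rewrite /cohomology_class pi_addr. Qed.

Definition cohomology_scale (a : k) (c : cohomology_mod) : cohomology_mod :=
  cohomology_class (a *: cohomology_repr c).

Lemma cohomology_scaleE a z :
  cohomology_scale a (cohomology_class z) = cohomology_class (a *: z).
Proof.
apply/cohomology_class_eq.
have /cohomology_class_eq[w ww] := cohomology_reprK (cohomology_class z).
by exists (a *: w); rewrite [RHS]linearZ /= -ww scalerBr.
Qed.

Lemma cohomology_scaleA a b c :
  cohomology_scale a (cohomology_scale b c) = cohomology_scale (a * b) c.
Proof. by rewrite -[c]cohomology_reprK !cohomology_scaleE scalerA. Qed.

Lemma cohomology_scale1 : left_id 1 cohomology_scale.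
Proof. by move=> c; rewrite -[c]cohomology_reprK cohomology_scaleE scale1r. Qed.

Lemma cohomology_scaleDr : right_distributive cohomology_scale +%R.
Proof.
move=> a b c; rewrite -[b]cohomology_reprK -[c]cohomology_reprK.
by rewrite -cohomology_class_zmod !cohomology_scaleE scalerDr cohomology_class_zmod.
Qed.

Lemma cohomology_scaleDl c : {morph cohomology_scale^~ c : a b / a + b}.
Proof.
move=> a b; rewrite -[c]cohomology_reprK !cohomology_scaleE scalerDl.
exact: cohomology_class_zmod.
Qed.

HB.instance Definition _ := GRing.Zmodule_isLmodule.Build k cohomology_mod
  cohomology_scaleA cohomology_scale1 cohomology_scaleDr cohomology_scaleDl.

Lemma cohomology_class_linear : linear cohomology_class.
Proof.
move=> a x y; rewrite cohomology_class_zmod; congr (_ + _).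
by rewrite -cohomology_scaleE.
Qed.

Lemma cohomology_class_eq0 (z : cocycle) :
  cohomology_class z = 0 <-> exists w, val z = d' w.
Proof.
have <- : cohomology_class 0 = 0.
  by have := cohomology_class_zmod 0 0; rewrite addr0 -{1}[LHS]addr0 => /addrI.
by rewrite cohomology_class_eq (_ : val (0 : cocycle) = 0) ?subr0.
Qed.

HB.instance Definition _ :=
  GRing.isLinear.Build k cocycle cohomology_mod _ cohomology_class
    cohomology_class_linear.

End CohomologyModule.

(** A product of modules, used below with [I] a fibre of an injective map. *)
Section ProductModule.
Variables (k : fieldType) (I : Type) (M : I -> lmodType k).

Definition prod_mod : Type := forall i, M i.

HB.instance Definition _ := gen_eqMixin prod_mod.
HB.instance Definition _ := gen_choiceMixin prod_mod.

Lemma prod_mod_addA : associative (fun s t : prod_mod => fun i => s i + t i).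
Proof. by move=> s t u; apply: functional_extensionality_dep => i; rewrite addrA. Qed.
Lemma prod_mod_addC : commutative (fun s t : prod_mod => fun i => s i + t i).
Proof. by move=> s t; apply: functional_extensionality_dep => i; rewrite addrC. Qed.
Lemma prod_mod_add0 :
  left_id (fun i => 0) (fun s t : prod_mod => fun i => s i + t i).
Proof. by move=> s; apply: functional_extensionality_dep => i; rewrite add0r. Qed.
Lemma prod_mod_addN : left_inverse (fun i => 0) (fun s : prod_mod => fun i => - s i)
  (fun s t : prod_mod => fun i => s i + t i).
Proof. by move=> s; apply: functional_extensionality_dep => i; rewrite addNr. Qed.

HB.instance Definition _ := GRing.isZmodule.Build prod_mod
  prod_mod_addA prod_mod_addC prod_mod_add0 prod_mod_addN.

Lemma prod_mod_scaleA (a b : k) (s : prod_mod) :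
  (fun i => a *: (b *: s i)) = (fun i => (a * b) *: s i).
Proof. by apply: functional_extensionality_dep => i; rewrite scalerA. Qed.
Lemma prod_mod_scale1 :
  left_id (1 : k) (fun a (s : prod_mod) => (fun i => a *: s i) : prod_mod).
Proof. by move=> s; apply: functional_extensionality_dep => i; rewrite scale1r. Qed.
Lemma prod_mod_scaleDr :
  right_distributive (fun (a : k) (s : prod_mod) => (fun i => a *: s i) : prod_mod) +%R.
Proof. by move=> a s t; apply: functional_extensionality_dep => i; exact: scalerDr. Qed.
Lemma prod_mod_scaleDl (s : prod_mod) :
  {morph (fun a : k => (fun i => a *: s i) : prod_mod) : a b / a + b}.
Proof. by move=> a b; apply: functional_extensionality_dep => i; exact: scalerDl. Qed.

HB.instance Definition _ := GRing.Zmodule_isLmodule.Build k prod_mod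
  prod_mod_scaleA prod_mod_scale1 prod_mod_scaleDr prod_mod_scaleDl.
End ProductModule.

(** A sheaf is given as an espace étalé: the family of its stalks together with
    the germs of its sections among all germs of families
    [s : forall x, stalk x]. [section_at x s] says that [s] is a section on some
    neighbourhood of [x]; the sections over an open set [U] are the families
    [s], restricted to [U], such that [section_at x s] for all [x] in [U]. The
    last two axioms say that the germs of sections at [x] are mapped bijectively
    to [stalk x] by evaluation at [x]. *)
Record sheaf (k : fieldType) (X : topologicalType) := Sheaf {
  stalk :> X -> lmodType k;
  section_at : forall x : X, (forall y, stalk y) -> Prop;
  section_near : forall x s, section_at x s -> \forall y \near x, section_at y s;
  section_ext : forall x s t,
    section_at x s -> (\forall y \near x, s y = t y) -> section_at x t;
  section_lin : forall x s t (a : k),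
    section_at x s -> section_at x t -> section_at x (fun y => a *: s y + t y);
  section_ex : forall x (e : stalk x), exists2 s, section_at x s & s x = e;
  section_eq0 : forall x s,
    section_at x s -> s x = 0 -> \forall y \near x, s y = 0 }.

Arguments section_at {k X} s x _ : rename.

Record sheaf_hom (k : fieldType) (X : topologicalType) (F G : sheaf k X) :=
  SheafHom {
  sheaf_fun :> forall x, {linear F x -> G x};
  sheaf_fun_section : forall x s,
    section_at F x s -> section_at G x (fun y => sheaf_fun y (s y)) }.

Section SheafTheory.
Variables (k : fieldType) (X : topologicalType).
Implicit Types F G H : sheaf k X.

Lemma section_sub F x s t : section_at F x s -> section_at F x t ->
  section_at F x (fun y => s y - t y).
Proof.
move=> Fs Ft; apply: (section_ext (section_lin (-1) Ft Fs)).
by apply: nearW => y; rewrite scaleN1r addrC.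
Qed.

Lemma section_eq F x s t : section_at F x s -> section_at F x t ->
  s x = t x -> \forall y \near x, s y = t y.
Proof.
move=> Fs Ft st; have := section_eq0 (section_sub Fs Ft).
rewrite st subrr => /(_ erefl); apply: filterS => y /eqP.
by rewrite subr_eq0 => /eqP.
Qed.

Lemma section_at0 F x : section_at F x (fun=> 0).
Proof.
have [s Fs s0] := section_ex (0 : F x).
by apply: (section_ext Fs); exact: section_eq0 s0.
Qed.

Definition sheaf_hom_eq F G (f g : sheaf_hom F G) : Prop :=
  forall x (e : F x), f x e = g x e.

Definition sheaf_id F : sheaf_hom F F :=
  @SheafHom k X F F (fun x => [the {linear F x -> F x} of idfun])
    (fun x s Fs => Fs).

Definition sheaf_comp F G H (g : sheaf_hom G H) (f : sheaf_hom F G) :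
    sheaf_hom F H :=
  @SheafHom k X F H (fun x => [the {linear F x -> H x} of g x \o f x])
    (fun x s Fs => sheaf_fun_section g (sheaf_fun_section f Fs)).

Lemma sheaf_comp_heq F G H (g g' : sheaf_hom G H) (f f' : sheaf_hom F G) :
  sheaf_hom_eq g g' -> sheaf_hom_eq f f' ->
  sheaf_hom_eq (sheaf_comp g f) (sheaf_comp g' f').
Proof. by move=> gg' ff' x e; rewrite /= ff' gg'. Qed.

End SheafTheory.

Definition Sh (k : fieldType) (X : topologicalType) : category := {|
  ob := sheaf k X;
  hom := @sheaf_hom k X;
  heq := @sheaf_hom_eq k X;
  idm := @sheaf_id k X;
  comp := @sheaf_comp k X;
  heq_refl := fun F G f x e => erefl;
  heq_sym := fun F G f g fg x e => esym (fg x e);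
  heq_trans := fun F G f g h fg gh x e => etrans (fg x e) (gh x e);
  comp_heq := @sheaf_comp_heq k X;
  compA := fun F G H K h g f x e => erefl;
  comp1m := fun F G f x e => erefl;
  compm1 := fun F G f x e => erefl |}.

Lemma linear_bij (k : fieldType) (M N : lmodType k) (f : {linear M -> N}) :
  bijective f -> exists g : {linear N -> M}, cancel f g /\ cancel g f.
Proof.
move=> [g fK gK]; have lin_g : linear g.
  by move=> a u v; apply: (can_inj fK); rewrite linearP !gK.
pose gl := GRing.isLinear.Build k N M _ g lin_g.
by exists (HB.pack g gl : {linear N -> M}).
Qed.

Lemma sheaf_isoP (k : fieldType) (X : topologicalType) (F G : Sh k X)
    (f : hom F G) :
  is_iso f <-> forall x, bijective (sheaf_fun f x).
Proof.
split=> [[g [gf fg]] x|fbij].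
  by exists (sheaf_fun g x) => e; [exact: gf|exact: fg].
have gP x := cid (linear_bij (fbij x)).
pose g x := sval (gP x).
have fK x : cancel (sheaf_fun f x) (g x) by case: (svalP (gP x)).
have gK x : cancel (g x) (sheaf_fun f x) by case: (svalP (gP x)).
have g_section x s : section_at G x s -> section_at F x (fun y => g y (s y)).
  move=> Gs; have [t Ft tx] := section_ex (g x (s x)).
  apply: (section_ext Ft).
  have := section_eq (sheaf_fun_section f Ft) Gs; rewrite tx gK => /(_ erefl).
  by apply: filterS => y <-; rewrite fK.
by exists (SheafHom g_section); split=> x e /=; [exact: fK|exact: gK].
Qed.

Section CohomologySheaf.
Variables (k : fieldType) (X : topologicalType) (L M N : sheaf k X).
Variables (d' : sheaf_hom L M) (d : sheaf_hom M N).

Let H x : lmodType k := cohomology_mod (d' x) (d x).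

Definition cohomology_section (x : X) (s : forall y, H y) : Prop :=
  exists2 t, section_at M x t &
    \forall y \near x, exists2 z : cocycle (d y),
      val z = t y & s y = cohomology_class (d' y) z.

Lemma cohomology_section_near x s : cohomology_section x s ->
  \forall y \near x, cohomology_section y s.
Proof.
move=> [t Mt /near_join tP]; have := section_near Mt.
by apply: filterS2 tP => y tP Mty; exists t.
Qed.

Lemma cohomology_section_ext x s s' : cohomology_section x s ->
  (\forall y \near x, s y = s' y) -> cohomology_section x s'.
Proof.
move=> [t Mt tP] ss'; exists t => //.
by apply: filterS2 tP ss' => y [z zt zs] ss'; exists z; rewrite -?ss'.
Qed.

Lemma cohomology_section_lin x s s' (a : k) : cohomology_section x s ->
  cohomology_section x s' -> cohomology_section x (fun y => a *: s y + s' y).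
Proof.
move=> [t Mt tP] [t' Mt' tP']; exists (fun y => a *: t y + t' y).
  exact: section_lin.
apply: filterS2 tP tP' => y [z zt zs] [z' zt' zs'].
by exists (a *: z + z'); [rewrite linearP /= zt zt'|rewrite linearP zs zs'].
Qed.

Lemma cohomology_section_ex x (c : H x) :
  exists2 s, cohomology_section x s & s x = c.
Proof.
pose z := cohomology_repr c; have [t Mt tz] := section_ex (val z).
pose s y : H y := if insub (t y) is Some z then cohomology_class (d' y) z else 0.
have dz : d x (val z) = 0 by apply/eqP; exact: (valP z).
exists s; last first.
  by rewrite /s tz valK; exact: cohomology_reprK.
exists t => //.
have := section_eq0 (sheaf_fun_section d Mt); rewrite tz => /(_ dz).
apply: filterS => y dty; have ty : t y \in cocycle_pred (d y) by apply/eqP.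
by exists (Sub (t y) ty); rewrite ?SubK // /s insubT.
Qed.

Lemma cohomology_section_eq0 x s :
  cohomology_section x s -> s x = 0 -> \forall y \near x, s y = 0.
Proof.
move=> [t Mt tP] sx0; have [z zt] := nbhs_singleton tP.
rewrite sx0 => /esym/cohomology_class_eq0[w]; rewrite zt => tw.
have [u Lu uw] := section_ex w.
have := section_eq Mt (sheaf_fun_section d' Lu); rewrite uw => /(_ tw).
apply: filterS2 tP => y [{}z {}zt ->] tu.
by apply/cohomology_class_eq0; exists (u y); rewrite zt.
Qed.

Definition cohomology_sheaf : sheaf k X :=
  @Sheaf k X H cohomology_section cohomology_section_near cohomology_section_ext
    cohomology_section_lin cohomology_section_ex cohomology_section_eq0.

End CohomologySheaf.

Lemma near_preimage (Y X : topologicalType) (f : Y -> X) (f_cont : continuous f)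
    (y : Y) (P : X -> Prop) :
  (\forall x \near f y, P x) -> \forall y' \near y, P (f y').
Proof. by move=> /f_cont. Qed.

Section Pullback.
Variables (k : fieldType) (Y X : topologicalType) (f : Y -> X).
Hypothesis f_cont : continuous f.

Section Sheaf.
Variable F : sheaf k X.

Definition pullback_section (y : Y) (t : forall y, F (f y)) : Prop :=
  exists2 s, section_at F (f y) s & \forall y' \near y, t y' = s (f y').

Lemma pullback_section_near y t :
  pullback_section y t -> \forall y' \near y, pullback_section y' t.
Proof.
move=> [s Fs /near_join ts].
by apply: filterS2 ts (f_cont (section_near Fs)) => y' ts Fs'; exists s.
Qed.

Lemma pullback_section_ext y t t' : pullback_section y t ->
  (\forall y' \near y, t y' = t' y') -> pullback_section y t'.
Proof.
move=> [s Fs ts] tt'; exists s => //.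
by apply: filterS2 ts tt' => y' <- ->.
Qed.

Lemma pullback_section_lin y t t' (a : k) : pullback_section y t ->
  pullback_section y t' -> pullback_section y (fun y => a *: t y + t' y).
Proof.
move=> [s Fs ts] [s' Fs' ts']; exists (fun x => a *: s x + s' x).
  exact: section_lin.
by apply: filterS2 ts ts' => y' -> ->.
Qed.

Lemma pullback_section_ex y (e : F (f y)) :
  exists2 t, pullback_section y t & t y = e.
Proof.
have [s Fs se] := section_ex e; exists (fun y => s (f y)) => //.
by exists s => //; exact: nearW.
Qed.

Lemma pullback_section_eq0 y t :
  pullback_section y t -> t y = 0 -> \forall y' \near y, t y' = 0.
Proof.
move=> [s Fs ts]; rewrite (nbhs_singleton ts) => /(section_eq0 Fs) s0.
by apply: filterS2 ts (f_cont s0) => y' ->.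
Qed.

Definition pullback_sheaf : sheaf k Y :=
  @Sheaf k Y (fun y => F (f y)) pullback_section
    pullback_section_near pullback_section_ext pullback_section_lin
    pullback_section_ex pullback_section_eq0.
End Sheaf.

Section Hom.
Variables (F G : sheaf k X) (phi : sheaf_hom F G).

Lemma pullback_hom_section y (t : forall y, F (f y)) :
  pullback_section y t -> pullback_section y (fun y => phi (f y) (t y)).
Proof.
move=> [s Fs ts]; exists (fun x => phi x (s x)); first exact: sheaf_fun_section.
by apply: filterS ts => y' ->.
Qed.

Definition pullback_hom : sheaf_hom (pullback_sheaf F) (pullback_sheaf G) :=
  @SheafHom k Y (pullback_sheaf F) (pullback_sheaf G) (fun y => phi (f y))
    pullback_hom_section.
End Hom.

Definition sheaf_pullback : functor (Sh k X) (Sh k Y) :=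
  @Functor (Sh k X) (Sh k Y) pullback_sheaf pullback_hom
    (fun F G p q pq y => pq (f y)) (fun F y e => erefl)
    (fun F G H q p y e => erefl).
End Pullback.

Record open_embedding (Y X : topologicalType) (f : Y -> X) : Prop :=
  OpenEmbedding {
  open_embedding_continuous : continuous f;
  open_embedding_inj : injective f;
  open_embedding_open : forall U : set Y, open U -> open (f @` U) }.

Section Shriek.
Variables (k : fieldType) (Y X : topologicalType) (f : Y -> X).
Hypothesis f_emb : open_embedding f.

Lemma open_embedding_near y (P : Y -> Prop) : (\forall y' \near y, P y') ->
  \forall x \near f y, exists2 y', f y' = x & P y'.
Proof.
move=> nP; have : nbhs y P by [].
rewrite nbhsE => -[U [oU Uy] UP].
have : nbhs (f y) (f @` U).
  apply: open_nbhs_nbhs; split; last by exists y.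
  exact: open_embedding_open f_emb _ oU.
by apply: filterS => x [y' /UP Py' <-]; exists y'.
Qed.

Section Sheaf.
Variable F : sheaf k Y.

(** The fibre of [f] at [x] has at most one point, so that this is [F y] if
    [x = f y], and zero if [x] is not in the range of [f]. *)
Definition shriek_stalk (x : X) : lmodType k :=
  prod_mod (fun p : {y : Y | f y = x} => F (sval p)).

Definition along (s : forall x, shriek_stalk x) (y : Y) : F y :=
  s (f y) (exist _ y erefl).

Definition shriek_section (x : X) (s : forall x, shriek_stalk x) : Prop :=
  (forall y, f y = x -> section_at F y (along s)) /\
  (~ range f x -> \forall x' \near x, s x' = 0).

Lemma shriek_section_in y s :
  section_at F y (along s) -> shriek_section (f y) s.
Proof.
move=> Fs; split=> [y' /(open_embedding_inj f_emb) -> //|].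
by case; exists y.
Qed.

Lemma shriek_section_near x s :
  shriek_section x s -> \forall x' \near x, shriek_section x' s.
Proof.
move=> [Fs s0]; have [[y _ yx]|xf] := pselect (range f x).
  have := open_embedding_near (section_near (Fs y yx)); rewrite yx.
  by apply: filterS => _ [y' <- Fs']; exact: shriek_section_in.
have /near_join := s0 xf; apply: filterS => x' s0'; split=> // y yx'.
apply: section_ext (section_at0 F y) _.
move: s0'; rewrite -yx' => /(near_preimage (open_embedding_continuous f_emb)).
by apply: filterS => y' s0''; rewrite /along s0''.
Qed.

Lemma shriek_section_ext x s t : shriek_section x s ->
  (\forall x' \near x, s x' = t x') -> shriek_section x t.
Proof.
move=> [Fs s0] st; split=> [y yx|xf].
  apply: section_ext (Fs y yx) _.
  move: st; rewrite -yx => /(near_preimage (open_embedding_continuous f_emb)).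
  by apply: filterS => y' st'; rewrite /along st'.
by apply: filterS2 (s0 xf) st => x' <-.
Qed.

Lemma shriek_section_lin x s t (a : k) : shriek_section x s ->
  shriek_section x t -> shriek_section x (fun x => a *: s x + t x).
Proof.
move=> [Fs s0] [Ft t0]; split=> [y yx|xf].
  exact: section_lin (Fs y yx) (Ft y yx).
by apply: filterS2 (s0 xf) (t0 xf) => x' -> ->; rewrite scaler0 addr0.
Qed.

Lemma shriek_section_ex x (e : shriek_stalk x) :
  exists2 s, shriek_section x s & s x = e.
Proof.
have [[y _ yx]|xf] := pselect (range f x).
  case: x / yx e => e.
  have [s Fs se] := section_ex (e (exist _ y erefl)).
  exists (fun x p => s (sval p)); first exact: shriek_section_in.
  apply: functional_extensionality_dep => -[y' yy'] /=.
  have y'y := open_embedding_inj f_emb yy'.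
  by case: _ / (esym y'y) yy' => yy'; rewrite se (Prop_irrelevance yy' erefl).
exists (fun=> 0).
  split=> [y _|_]; [exact: section_at0|exact: nearW].
by apply: functional_extensionality_dep => -[y yx]; case: xf; exists y.
Qed.

Lemma shriek_section_eq0 x s :
  shriek_section x s -> s x = 0 -> \forall x' \near x, s x' = 0.
Proof.
move=> [Fs s0] sx; have [[y _ yx]|] := pselect (range f x); last exact: s0.
case: x / yx Fs {s0} sx => Fs sx.
have /(section_eq0 (Fs y erefl)) : along s y = 0 by rewrite /along sx.
move=> /open_embedding_near; apply: filterS => _ [y' <- sy'].
apply: functional_extensionality_dep => -[y'' yy''] /=.
have y''y' := open_embedding_inj f_emb yy''.
case: _ / (esym y''y') yy'' => yy''.
by rewrite (Prop_irrelevance yy'' erefl) -[RHS]sy'.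
Qed.

Definition shriek_sheaf : sheaf k X :=
  @Sheaf k X shriek_stalk shriek_section
    shriek_section_near shriek_section_ext shriek_section_lin
    shriek_section_ex shriek_section_eq0.
End Sheaf.

Section Hom.
Variables (F G : sheaf k Y) (phi : sheaf_hom F G).

Definition shriek_map x (e : shriek_stalk F x) : shriek_stalk G x :=
  fun p => phi (sval p) (e p).

Lemma shriek_map_linear x : linear (@shriek_map x).
Proof.
by move=> a u v; apply: functional_extensionality_dep => p; exact: linearP.
Qed.

HB.instance Definition _ x := GRing.isLinear.Build k (shriek_stalk F x)
  (shriek_stalk G x) _ (@shriek_map x) (@shriek_map_linear x).

Lemma shriek_hom_section x (s : forall x, shriek_stalk F x) :
  shriek_section x s -> shriek_section x (fun x => shriek_map (s x)).
Proof.
move=> [Fs s0]; split=> [y yx|/s0].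
  exact: (sheaf_fun_section phi (Fs y yx)).
by apply: filterS => x' ->; exact: linear0.
Qed.

Definition shriek_hom : sheaf_hom (shriek_sheaf F) (shriek_sheaf G) :=
  @SheafHom k X (shriek_sheaf F) (shriek_sheaf G)
    (fun x => [the {linear shriek_stalk F x -> shriek_stalk G x} of @shriek_map x])
    shriek_hom_section.
End Hom.

Lemma shriek_hom_heq (F G : sheaf k Y) (p q : sheaf_hom F G) :
  sheaf_hom_eq p q -> sheaf_hom_eq (shriek_hom p) (shriek_hom q).
Proof.
by move=> pq x e; apply: functional_extensionality_dep => y; exact: pq.
Qed.

Definition sheaf_shriek : functor (Sh k Y) (Sh k X) :=
  @Functor (Sh k Y) (Sh k X) shriek_sheaf shriek_hom
    shriek_hom_heq (fun F x e => erefl) (fun F G H q p x e => erefl).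
End Shriek.

(** Bounded complexes. [cdiff m n] is the differential if [n = m + 1], and zero
    otherwise. *)
Record complex (k : fieldType) (X : topologicalType) := Complex {
  cterm :> int -> sheaf k X;
  cdiff : forall m n, sheaf_hom (cterm m) (cterm n);
  diff_shape : forall m n x (e : cterm m x), n != m + 1 -> cdiff m n x e = 0;
  diff_diff : forall m n p x (e : cterm m x), cdiff n p x (cdiff m n x e) = 0;
  term_bounded : exists N : int, forall n, N < `|n| ->
    forall x (e : cterm n x), e = 0 }.

Record complex_map (k : fieldType) (X : topologicalType) (F G : complex k X) :=
  ComplexMap {
  map_term :> forall n, sheaf_hom (F n) (G n);
  map_diff : forall m n x (e : F m x),
    map_term n x (cdiff F m n x e) = cdiff G m n x (map_term m x e) }.

Section Complexes.
Variables (k : fieldType) (X : topologicalType).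
Implicit Types F G H : complex k X.

Definition complex_map_eq F G (f g : complex_map F G) : Prop :=
  forall n, sheaf_hom_eq (f n) (g n).

Definition complex_id F : complex_map F F :=
  @ComplexMap k X F F (fun n => sheaf_id (F n)) (fun m n x e => erefl).

Lemma complex_comp_diff F G H (g : complex_map G H) (f : complex_map F G)
    m n x (e : F m x) :
  sheaf_comp (g n) (f n) x (cdiff F m n x e) =
  cdiff H m n x (sheaf_comp (g m) (f m) x e).
Proof. by rewrite /= !map_diff. Qed.

Definition complex_comp F G H (g : complex_map G H) (f : complex_map F G) :
    complex_map F H :=
  ComplexMap (complex_comp_diff g f).

Lemma complex_comp_heq F G H (g g' : complex_map G H) (f f' : complex_map F G) :
  complex_map_eq g g' -> complex_map_eq f f' ->
  complex_map_eq (complex_comp g f) (complex_comp g' f').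
Proof. by move=> gg' ff' n; apply: sheaf_comp_heq. Qed.

End Complexes.

Definition Cb (k : fieldType) (X : topologicalType) : category := {|
  ob := complex k X;
  hom := @complex_map k X;
  heq := @complex_map_eq k X;
  idm := @complex_id k X;
  comp := @complex_comp k X;
  heq_refl := fun F G f n x e => erefl;
  heq_sym := fun F G f g fg n x e => esym (fg n x e);
  heq_trans := fun F G f g h fg gh n x e => etrans (fg n x e) (gh n x e);
  comp_heq := @complex_comp_heq k X;
  compA := fun F G H K h g f n x e => erefl;
  comp1m := fun F G f n x e => erefl;
  compm1 := fun F G f n x e => erefl |}.

Section Cohomology.
Variables (k : fieldType) (X : topologicalType).
Implicit Types F G : complex k X.

Definition cohomology F (n : int) : sheaf k X :=
  cohomology_sheaf (cdiff F (n - 1) n) (cdiff F n (n + 1)).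

Section Map.
Variables (F G : complex k X) (f : complex_map F G) (n : int).

Lemma cohomology_map_subproof x (z : cocycle (cdiff F n (n + 1) x)) :
  f n x (val z) \in cocycle_pred (cdiff G n (n + 1) x).
Proof. by apply/eqP; rewrite -map_diff (eqP (valP z)) linear0. Qed.

Definition cocycle_map x (z : cocycle (cdiff F n (n + 1) x)) :
    cocycle (cdiff G n (n + 1) x) :=
  Sub (f n x (val z)) (cohomology_map_subproof z).

Definition cohomology_map_fun x (c : cohomology F n x) : cohomology G n x :=
  cohomology_class (cdiff G (n - 1) n x) (cocycle_map (cohomology_repr c)).

Lemma cohomology_map_class x (z : cocycle (cdiff F n (n + 1) x)) :
  cohomology_map_fun (cohomology_class (cdiff F (n - 1) n x) z) =
  cohomology_class (cdiff G (n - 1) n x) (cocycle_map z).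
Proof.
apply/cohomology_class_eq.
have /cohomology_class_eq[w ww] :=
  cohomology_reprK (cohomology_class (cdiff F (n - 1) n x) z).
by exists (f (n - 1) x w); rewrite !SubK -map_diff -ww linearB.
Qed.

Lemma cohomology_map_linear x : linear (@cohomology_map_fun x).
Proof.
move=> a c c'; rewrite -[c]cohomology_reprK -[c']cohomology_reprK.
rewrite -linearP !cohomology_map_class -linearP; congr cohomology_class.
by apply: val_inj; rewrite [LHS]linearP.
Qed.

HB.instance Definition _ x := GRing.isLinear.Build k (cohomology F n x)
  (cohomology G n x) _ (@cohomology_map_fun x) (@cohomology_map_linear x).

Lemma cohomology_map_section x (s : forall x, cohomology F n x) :
  section_at (cohomology F n) x s ->
  section_at (cohomology G n) x (fun x => cohomology_map_fun (s x)).
Proof.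
move=> [t Ft ts]; exists (fun x => f n x (t x)); first exact: sheaf_fun_section.
apply: filterS ts => y [z zt sz]; exists (cocycle_map z); first by rewrite SubK zt.
by rewrite sz cohomology_map_class.
Qed.

Definition cohomology_map : sheaf_hom (cohomology F n) (cohomology G n) :=
  @SheafHom k X (cohomology F n) (cohomology G n)
    (fun x => [the {linear cohomology F n x -> cohomology G n x}
               of @cohomology_map_fun x])
    cohomology_map_section.

End Map.

Definition quasi_iso F G (f : complex_map F G) : Prop :=
  forall n, @is_iso (Sh k X) _ _ (cohomology_map f n).

Lemma quasi_isoP F G (f : complex_map F G) :
  quasi_iso f <-> forall n x,
    (forall e : F n x, cdiff F n (n + 1) x e = 0 ->
      (exists w, f n x e = cdiff G (n - 1) n x w) ->
      exists w, e = cdiff F (n - 1) n x w) /\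
    (forall e : G n x, cdiff G n (n + 1) x e = 0 ->
      exists2 e', cdiff F n (n + 1) x e' = 0 &
        exists w, f n x e' - e = cdiff G (n - 1) n x w).
Proof.
split=> qf n.
  move=> x; have /sheaf_isoP/(_ x)[g fK gK] := qf n; split=> e /eqP de.
    move=> [w ew]; pose z : cocycle (cdiff F n (n + 1) x) := Sub e de.
    have : cohomology_class (cdiff F (n - 1) n x) z = 0.
      apply: (can_inj fK); rewrite linear0 /= cohomology_map_class.
      by apply/cohomology_class_eq0; exists w; rewrite !SubK.
    by move=> /cohomology_class_eq0[w' w'e]; exists w'; rewrite -w'e SubK.
  pose z : cocycle (cdiff G n (n + 1) x) := Sub e de.
  have := gK (cohomology_class (cdiff G (n - 1) n x) z).
  rewrite -[g _]cohomology_reprK /= cohomology_map_class.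
  move=> /cohomology_class_eq[w]; rewrite !SubK => ew.
  by eexists; [exact/eqP/(valP (cohomology_repr (g (cohomology_class _ z))))|exists w].
apply/sheaf_isoP => x; have [finj fsurj] := qf n x.
pose h c : cohomology G n x := cohomology_map f n x c.
have h_inj : injective h.
  suff h0 c : h c = 0 -> c = 0.
    move=> c c' cc'; apply/eqP; rewrite -subr_eq0; apply/eqP/h0.
    by rewrite /h raddfB /= -/(h c) -/(h c') cc' subrr.
  rewrite -[c]cohomology_reprK; set z := cohomology_repr c.
  rewrite /h /= cohomology_map_class => /cohomology_class_eq0[w zw].
  apply/cohomology_class_eq0; apply: finj; first exact: (eqP (valP z)).
  by exists w; rewrite -zw SubK.
have h_surj c : exists c', h c' = c.
  rewrite -[c]cohomology_reprK; set z := cohomology_repr c.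
  have [e /eqP de [w ew]] := fsurj _ (eqP (valP z)).
  exists (cohomology_class (cdiff F (n - 1) n x) (Sub e de)).
  rewrite /h /= cohomology_map_class; apply/cohomology_class_eq.
  by exists w; rewrite !SubK.
have /choice[g gK] := h_surj; exists g => c; last exact: gK.
by apply: h_inj; rewrite gK.
Qed.

End Cohomology.

(** The bounded derived category, as the localization of the category of
    bounded complexes at the quasi-isomorphisms. *)
Definition Db (k : fieldType) (X : topologicalType) : category :=
  @localization (Cb k X) (@quasi_iso k X).

(** The functors [f^-1] and, for an open embedding [f], [f_!] are exact on
    sheaves: their derived functors are computed termwise. *)
Section TermwiseFunctor.
Variables (k : fieldType) (Y X : topologicalType).
Variable T : functor (Sh k Y) (Sh k X).
Hypothesis T_zero : forall (F G : Sh k Y) (f : hom F G),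
  (forall y e, sheaf_fun f y e = 0) -> forall x e, sheaf_fun (fhom T f) x e = 0.

Section Object.
Variable F : complex k Y.

Let TF n : sheaf k X := T (F n).
Let Td m n : sheaf_hom (TF m) (TF n) :=
  @fhom _ _ T (F m : Sh k Y) (F n : Sh k Y) (cdiff F m n).

Lemma termwise_shape m n x (e : TF m x) : n != m + 1 -> Td m n x e = 0.
Proof. by move=> nm; apply: T_zero => y e'; exact: diff_shape. Qed.

Lemma termwise_diff m n p x (e : TF m x) : Td n p x (Td m n x e) = 0.
Proof.
have /= <- := fhom_comp T (cdiff F n p : @hom (Sh k Y) (F n) (F p))
  (cdiff F m n : @hom (Sh k Y) (F m) (F n)) x e.
by apply: T_zero => y e'; exact: diff_diff.
Qed.

Lemma termwise_bounded : exists N : int, forall n, N < `|n| ->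
  forall x (e : TF n x), e = 0.
Proof.
have [N FN] := term_bounded F; exists N => n /FN Fn x e.
by have /= <- := fhom_id T (F n : Sh k Y) x e; apply: T_zero => y e'; exact: Fn.
Qed.

Definition termwise_complex : complex k X :=
  Complex termwise_shape termwise_diff termwise_bounded.
End Object.

Lemma termwise_map_diff (F G : complex k Y) (f : complex_map F G) m n x
    (e : termwise_complex F m x) :
  sheaf_fun (@fhom _ _ T (F n : Sh k Y) (G n : Sh k Y) (f n)) x
    (cdiff (termwise_complex F) m n x e) =
  cdiff (termwise_complex G) m n x
    (sheaf_fun (@fhom _ _ T (F m : Sh k Y) (G m : Sh k Y) (f m)) x e).
Proof.
have /= <- := fhom_comp T (f n : @hom (Sh k Y) (F n) (G n))
  (cdiff F m n : @hom (Sh k Y) (F m) (F n)) x e.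
have /= <- := fhom_comp T (cdiff G m n : @hom (Sh k Y) (G m) (G n))
  (f m : @hom (Sh k Y) (F m) (G m)) x e.
apply: (fhom_heq T (x := F m : Sh k Y) (y := G n : Sh k Y)) => y e'.
exact: map_diff.
Qed.

Definition termwise_map (F G : complex k Y) (f : complex_map F G) :
    complex_map (termwise_complex F) (termwise_complex G) :=
  @ComplexMap k X (termwise_complex F) (termwise_complex G)
    (fun n => @fhom _ _ T (F n : Sh k Y) (G n : Sh k Y) (f n))
    (termwise_map_diff f).

Definition termwise_functor : functor (Cb k Y) (Cb k X) :=
  @Functor (Cb k Y) (Cb k X) termwise_complex termwise_map
    (fun F G f g fg n => fhom_heq T (fg n))
    (fun F n => fhom_id T (F n : Sh k Y))
    (fun F G H g f n => fhom_comp T (g n : @hom (Sh k Y) (G n) (H n))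
      (f n : @hom (Sh k Y) (F n) (G n))).

Hypothesis T_exact : forall (F G : complex k Y) (f : complex_map F G),
  quasi_iso f -> quasi_iso (termwise_map f).

Definition derived_functor : functor (Db k Y) (Db k X) :=
  @localize_functor (Cb k Y) (Cb k X) termwise_functor _ _ T_exact.

End TermwiseFunctor.

Section PullbackDb.
Variables (k : fieldType) (Y X : topologicalType) (f : Y -> X).
Hypothesis f_cont : continuous f.

Lemma pullback_zero (F G : Sh k X) (p : hom F G) :
  (forall x e, sheaf_fun p x e = 0) ->
  forall y e, sheaf_fun (fhom (sheaf_pullback k f_cont) p) y e = 0.
Proof. by move=> p0 y e; exact: p0. Qed.

Lemma pullback_exact (F G : complex k X) (p : complex_map F G) :
  quasi_iso p -> quasi_iso (termwise_map pullback_zero p).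
Proof.
by move=> /quasi_isoP qp; apply/quasi_isoP => n y; exact: (qp n (f y)).
Qed.

(** [f^-1] *)
Definition pullback : functor (Db k X) (Db k Y) := derived_functor pullback_exact.
End PullbackDb.

Section ShriekDb.
Variables (k : fieldType) (Y X : topologicalType) (f : Y -> X).
Hypothesis f_emb : open_embedding f.

Lemma shriek_zero (F G : Sh k Y) (p : hom F G) :
  (forall y e, sheaf_fun p y e = 0) ->
  forall x e, sheaf_fun (fhom (sheaf_shriek k f_emb) p) x e = 0.
Proof.
by move=> p0 x e; apply: functional_extensionality_dep => q; exact: p0.
Qed.

Lemma shriek_exact (F G : complex k Y) (p : complex_map F G) :
  quasi_iso p -> quasi_iso (termwise_map shriek_zero p).
Proof.
move=> /quasi_isoP qp; apply/quasi_isoP => n x; split=> e de.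
  move=> [w pe].
  have H q : exists v, e q = cdiff F (n - 1) n (sval q) v.
    apply: (qp n (sval q)).1; first exact: (congr1 (@^~ q) de).
    by exists (w q); exact: (congr1 (@^~ q) pe).
  exists (fun q => sval (cid (H q))).
  by apply: functional_extensionality_dep => q; exact: (svalP (cid (H q))).
have H q : exists e', cdiff F n (n + 1) (sval q) e' = 0 /\
    exists w, p n (sval q) e' - e q = cdiff G (n - 1) n (sval q) w.
  have [|e' de' we'] := (qp n (sval q)).2 (e q); last by exists e'.
  exact: (congr1 (@^~ q) de).
exists (fun q => sval (cid (H q))).
  by apply: functional_extensionality_dep => q; exact: (svalP (cid (H q))).1.
exists (fun q => sval (cid (svalP (cid (H q))).2)).
by apply: functional_extensionality_dep => q; exact: (svalP (cid (svalP (cid (H q))).2)).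
Qed.

(** [f_!] *)
Definition shriek : functor (Db k Y) (Db k X) := derived_functor shriek_exact.
End ShriekDb.

Arguments pullback k {Y X f} f_cont.
Arguments shriek k {Y X f} f_emb.

Lemma set_val_continuous (X : topologicalType) (A : set X) :
  continuous (set_val : A -> X).
Proof. exact: initial_continuous. Qed.

(** [F|_A] *)
Definition restriction (k : fieldType) (X : topologicalType) (A : set X) :
  functor (Db k X) (Db k A) := pullback k (@set_val_continuous X A).

Section ZeroObject.
Variables (k : fieldType) (X : topologicalType).

Definition zero_sheaf : sheaf k X.
Proof.
refine (@Sheaf k X (fun=> 'rV[k]_0 : lmodType k) (fun _ _ => True) _ _ _ _ _) => //.
- by move=> *; exact: nearW.
- by move=> x e; exists (fun=> e).
- by move=> x s _ _; apply: nearW => y; rewrite [LHS]thinmx0.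
Defined.

Definition zero_complex : complex k X.
Proof.
refine (@Complex k X (fun=> zero_sheaf)
  (fun m n => sheaf_id zero_sheaf) _ _ _).
- by move=> *; exact: thinmx0.
- by move=> *; exact: thinmx0.
- by exists 0 => *; exact: thinmx0.
Defined.

Definition is_zero (F : Db k X) : Prop := isomorphic F (zero_complex : Db k X).
End ZeroObject.

(** An object is constant of finite rank if it is the inverse image of an object
    with finite-dimensional cohomology over the point. *)
Definition point_space : topologicalType := discrete_topology unit.

Definition to_point (X : topologicalType) (x : X) : point_space := tt.

Lemma to_point_continuous (X : topologicalType) : continuous (@to_point X).
Proof. exact: cst_continuous. Qed.

Section Constant.
Variables (k : fieldType) (X : topologicalType).

Definition constant_finite_rank (F : Db k X) : Prop :=
  exists2 L : Db k point_space,
    (forall n, finite_dimensional (cohomology L n tt)) &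
    isomorphic F (pullback k (@to_point_continuous X) L).

Definition constant_sheaf_finite_rank (F : Sh k X) : Prop :=
  exists2 L : Sh k point_space, finite_dimensional (stalk L tt) &
    isomorphic F (sheaf_pullback k (@to_point_continuous X) L).
End Constant.

Definition sheaf_restriction (k : fieldType) (X : topologicalType) (A : set X) :
  functor (Sh k X) (Sh k A) := sheaf_pullback k (@set_val_continuous X A).

Definition locally_constant_finite_rank (k : fieldType) (X : topologicalType)
    (F : Sh k X) : Prop :=
  forall x : X, exists U : set X, [/\ open U, U x &
    constant_sheaf_finite_rank (sheaf_restriction k U F)].

(** The norm of [E] is only used through its topology, which does not depend on
    it if [E] is finite-dimensional. *)
Section PiecewiseLinear.
Variables (R : realType) (k : fieldType) (E : normedModType R).

Definition half_space (H : set E) : Prop :=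
  exists (l : {scalar E}) (c : R), (exists v, l v != 0) /\
    (H = [set v | l v < c] \/ H = [set v | l v <= c]).

Definition convex_polyhedron (P : set E) : Prop :=
  exists (n : nat) (H : 'I_n -> set E),
    (forall i, half_space (H i)) /\ P = \bigcap_i H i.

Definition PL (F : Db k E) : Prop :=
  exists (n : nat) (P : 'I_n -> set E),
    [/\ forall a, convex_polyhedron (P a), \bigcup_a P a = setT &
        forall a, constant_finite_rank (restriction k (P a) F)].

Definition DbPL : category := full_subcategory PL.
End PiecewiseLinear.

Section Subanalytic.
Variable R : realType.

(** Partial sums, over the boxes [{0, ..., N - 1}^n], of a family indexed by
    [n]-multi-indices. *)
Definition box_sum n (u : ('I_n -> nat) -> R) (N : nat) : R :=
  \sum_(al : {ffun 'I_n -> 'I_N}) u (fun i => al i).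

Definition analytic_at n (f : 'rV[R]_n -> R) (a : 'rV[R]_n) : Prop :=
  exists (c : ('I_n -> nat) -> R) (r : R),
    [/\ 0 < r, cvgn (box_sum (fun al => `|c al| * r ^+ (\sum_i al i)%N)) &
      forall x : 'rV[R]_n, (forall i, `|x 0 i - a 0 i| < r) ->
        box_sum (fun al => c al * \prod_i (x 0 i - a 0 i) ^+ al i) @ \oo
          --> f x].

(** Locally a finite union of sets, each defined by finitely many conditions
    [g = 0] or [0 < g] with [g] real analytic. *)
Definition semianalytic n (S : set 'rV[R]_n) : Prop :=
  forall a, exists U : set 'rV[R]_n, [/\ open U, U a &
    exists (p q : nat) (g : 'I_p -> 'I_q -> 'rV[R]_n -> R)
      (strict : 'I_p -> 'I_q -> bool),
      (forall i j x, U x -> analytic_at (g i j) x) /\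
      (forall x, U x -> S x <-> exists i, forall j,
        if strict i j then 0 < g i j x else g i j x == 0)].

(** Locally the image, under a projection [R^(n + m) -> R^n], of a bounded
    semianalytic set. *)
Definition subanalytic n (A : set 'rV[R]_n) : Prop :=
  forall a, exists U : set 'rV[R]_n, [/\ open U, U a &
    exists (m : nat) (S : set 'rV[R]_(n + m)),
      [/\ semianalytic S, bounded_set S &
        forall x, U x -> A x <-> exists y, S (row_mx x y)]].
End Subanalytic.

Section Projective.
Variables (R : realType) (V : normedModType R).

Local Notation W := (V * R)%type.

Definition punctured : set W := [set w | w != 0].

Lemma val_punctured_neq0 (w : punctured) : set_val w != 0.
Proof. exact: set_mem (svalP w). Qed.

Definition collinear (w w' : punctured) : bool :=
  `[< exists2 c : R, c != 0 & set_val w' = c *: set_val w >].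

Lemma collinear_refl : reflexive collinear.
Proof. by move=> w; apply/asboolP; exists 1; rewrite ?oner_neq0 ?scale1r. Qed.

Lemma collinear_sym : symmetric collinear.
Proof.
suff H w w' : collinear w w' -> collinear w' w.
  by move=> w w'; apply/idP/idP; exact: H.
move=> /asboolP[c c0 ww']; apply/asboolP; exists c^-1; first by rewrite invr_eq0.
by rewrite ww' scalerA mulVf// scale1r.
Qed.

Lemma collinear_trans : transitive collinear.
Proof.
move=> w2 w1 w3 /asboolP[c c0 w12] /asboolP[c' c'0 w23]; apply/asboolP.
by exists (c' * c); rewrite ?mulf_neq0// w23 w12 scalerA.
Qed.

Definition collinear_equiv : equiv_rel punctured :=
  EquivRel collinear collinear_refl collinear_sym collinear_trans.

Definition proj_space : topologicalType :=
  quotient_topology {eq_quot collinear_equiv}.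

(** [pi] *)
Definition to_proj (w : punctured) : proj_space :=
  \pi_(quotient_topology {eq_quot collinear_equiv}) w.

Lemma to_proj_continuous : continuous to_proj.
Proof. exact: pi_continuous. Qed.

Lemma to_proj_eq w w' : to_proj w = to_proj w' <-> collinear w w'.
Proof. by split=> [/eqquotP|ww']; last exact/eqquotP. Qed.

Lemma affine_neq0 (v : V) : (v, 1 : R) \in punctured.
Proof. by apply/mem_set/eqP => -[_ /eqP]; rewrite oner_eq0. Qed.

Definition affine_lift (v : V) : punctured := exist _ (v, 1) (affine_neq0 v).

(** [j] *)
Definition affine_embed (v : V) : proj_space := to_proj (affine_lift v).

Definition hyperplane_at_infinity : set proj_space := ~` range affine_embed.

Lemma punctured_open : open punctured.
Proof.
rewrite (_ : punctured = ~` [set 0]); last first.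
  by apply/seteqP; split=> w /=; [move/eqP|move=> /eqP].
apply: closed_openC; apply: accessible_closed_set1.
by apply: hausdorff_accessible; exact: norm_hausdorff.
Qed.

(** [iota] *)
Lemma punctured_open_embedding :
  open_embedding (set_val : punctured -> W).
Proof.
split; first exact: set_val_continuous.
  by move=> w w' ww'; exact: val_inj.
move=> _ [D openD <-].
rewrite (_ : _ @` _ = punctured `&` D); first exact: openI punctured_open openD.
apply/seteqP; split=> [_ [w Dw <-]|w [/mem_set w0 Dw]].
  by split=> //; exact: val_punctured_neq0.
by exists (exist _ w w0).
Qed.

Lemma affine_embed_open_embedding : open_embedding affine_embed.
Proof.
split.
- have lift_cont : continuous affine_lift.
    apply/continuousP => _ [D openD <-]; rewrite -comp_preimage.
    have /continuousP : continuous (fun v : V => (v, 1) : W); last exact.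
    by move=> v; apply: (@cvg_pair _ _ _ (nbhs v) (nbhs v) (nbhs (1 : R)));
      [exact: cvg_id|exact: cvg_cst].
  by move=> v; apply: continuous_comp; [exact: lift_cont|exact: to_proj_continuous].
- move=> v v' /to_proj_eq/asboolP[c _ [+ c1]].
  by move: c1; rewrite /= [c *: 1]mulr1 => <-; rewrite scale1r.
move=> U oU; rewrite /open /= /quotient_open /=.
pose D : set W := [set w | w.2 != 0 /\ U (w.2^-1 *: w.1)].
suff openD : open D.
  exists D => //; apply/seteqP; split=> w.
    move=> [w20 Uw]; exists ((set_val w).2^-1 *: (set_val w).1) => //.
    apply/to_proj_eq/asboolP; exists (set_val w).2 => //.
    rewrite [LHS]surjective_pairing; apply/pair_equal_spec; split=> /=.
      by rewrite scalerA mulfV// scale1r.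
    by rewrite [RHS]mulr1.
  move=> [v Uv /to_proj_eq/asboolP[c c0 wv]]; rewrite /D /= wv /=.
  by rewrite [c *: 1]mulr1 scalerA mulVf// scale1r.
rewrite openE => w [w20 Uw]; rewrite /interior.
have cw : {for w, continuous (fun w : W => w.2^-1 *: w.1)}.
  apply: (@cvgZ _ _ _ (nbhs w) _ (fun w : W => w.2^-1) (fun w : W => w.1)).
    by apply: (@cvgV _ _ (nbhs w) _ (fun w : W => w.2)) => //; case: w {w20 Uw} => *; exact: cvg_snd.
  by case: w {w20 Uw} => *; exact: cvg_fst.
have nU : nbhs (w.2^-1 *: w.1) U by exact: open_nbhs_nbhs.
have n0 : \forall w' \near w, w'.2 != 0.
  have : nbhs w.2 [set t : R | t != 0].
    by apply: open_nbhs_nbhs; split=> //; exact: open_neq.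
  by case: w {w20 Uw cw nU} => v t; exact: cvg_snd.
by apply: filterS2 n0 (cw _ nU) => w'.
Qed.

(** The affine charts of the projective space are the maps
    [t |-> [b (1, t)]], for the linear isomorphisms [b : R^(1 + n) -> V x R];
    [affine_chart b A] is the preimage of [A] under this map. *)
Definition affine_chart n (b : {linear 'rV[R]_(1 + n) -> W}) (A : set proj_space) :
  set 'rV[R]_n :=
  [set t | exists2 w : punctured, set_val w = b (row_mx 1 t) & A (to_proj w)].

Definition proj_subanalytic (A : set proj_space) : Prop :=
  forall n (b : {linear 'rV[R]_(1 + n) -> W}),
    bijective b -> subanalytic (affine_chart b A).

Variable k : fieldType.

(** [R]-constructible sheaves, in the sense of Kashiwara and Schapira: the sheaf
    is locally constant of finite rank on each member of a locally finite
    covering by subanalytic subsets. *)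
Definition constructible_sheaf (F : Sh k proj_space) : Prop :=
  exists (I : Type) (A : I -> set proj_space),
    [/\ forall x, exists U : set proj_space,
          [/\ open U, U x & finite_set [set i | A i `&` U !=set0]],
        \bigcup_i A i = setT,
        forall i, proj_subanalytic (A i) &
        forall i, locally_constant_finite_rank (sheaf_restriction k (A i) F)].

Definition Rconstructible (F : Db k proj_space) : Prop :=
  forall n, constructible_sheaf (cohomology F n).

Definition PL_proj (F : Db k proj_space) : Prop :=
  Rconstructible F /\
  PL (shriek k punctured_open_embedding (pullback k to_proj_continuous F)).

Definition DbPL_proj : category := full_subcategory PL_proj.

(** [j_!] *)
Definition j_shriek : functor (Db k V) (Db k proj_space) :=
  shriek k affine_embed_open_embedding.

Definition restriction_at_infinity :
    functor (Db k proj_space) (Db k hyperplane_at_infinity) :=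
  restriction k hyperplane_at_infinity.

End Projective.

(* Main.v *)
Require Import Defs.
From HB Require Import structures.
From mathcomp Require Import all_boot all_order all_algebra.
From mathcomp Require Import all_classical all_reals all_analysis.
From mathcomp Require Import ring.

(** For an open embedding [f], [f^-1 f_! = id] and the counit [f_! f^-1 -> id]
    already exist termwise on complexes; they extend to the localization, so
    that [f_!] is fully faithful, and the counit at [G] is a quasi-isomorphism if
    [G] is acyclic outside the range of [f]. This settles everything but the
    piecewise linear structure. The cone over a polyhedron of [V] is the union of
    two half-cones, which are polyhedra of [V x R], and these together with the
    hyperplane [w.2 = 0] cover [V x R]; in the affine charts of the projective
    space they are semilinear, hence subanalytic. Conversely, the slices
    [{v | (v, 1) \in Q}] of the polyhedra [Q] that trivialize
    [iota_! pi^-1 G] trivialize [j^-1 G]. *)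

Set Implicit Arguments.
Unset Strict Implicit.
Unset Printing Implicit Defensive.

Import Order.TTheory GRing.Theory Num.Theory numFieldNormedType.Exports.
(* [hom] and [comp] are shadowed by MathComp. *)
Import Defs.

Local Open Scope classical_set_scope.
Local Open Scope ring_scope.

(** * Categories and localizations *)

Section Isomorphisms.
Variable C : category.

Lemma isomorphic_sym (x y : C) : isomorphic x y -> isomorphic y x.
Proof. by move=> [f [g [gf fg]]]; exists g, f. Qed.

Lemma comp_cancel (x y z t : C) (h : hom z t) (g : hom y z) (g' : hom z y)
    (f : hom x z) :
  heq (comp g g') (idm z) -> heq (comp (comp h g) (comp g' f)) (comp h f).
Proof.
move=> gg'; apply: heq_trans (heq_sym (compA _ _ _)) _.
apply: comp_heq (heq_refl _) _; apply: heq_trans (compA _ _ _) _.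
exact: heq_trans (comp_heq gg' (heq_refl _)) (comp1m _).
Qed.

Lemma isomorphic_trans (x y z : C) :
  isomorphic x y -> isomorphic y z -> isomorphic x z.
Proof.
move=> [f [g [gf fg]]] [f' [g' [gf' fg']]]; exists (comp f' f), (comp g g').
by split; [apply: heq_trans (comp_cancel _ _ gf') _|
  apply: heq_trans (comp_cancel _ _ fg) _].
Qed.

Lemma iso_cancel (x y z : C) (f g : hom x y) (a : hom z x) :
  is_iso a -> heq (comp f a) (comp g a) -> heq f g.
Proof.
move=> [b [_ ab]] fg.
have E (h : hom x y) : heq (comp (comp h a) b) h.
  apply: heq_trans (heq_sym (compA _ _ _)) _.
  exact: heq_trans (comp_heq (heq_refl _) ab) (compm1 _).
apply: heq_trans (heq_sym (E f)) _; apply: heq_trans (E g).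
exact: comp_heq fg (heq_refl _).
Qed.

(** Insert [w' v'] in front of [a w], commute by the square and cancel [v w]. This carries
    naturality from a morphism to its inverse. *)
Lemma square_inverse (x y x' y' : C) (a : hom x x') (b : hom y y')
    (v : hom x y) (w : hom y x) (v' : hom x' y') (w' : hom y' x') :
  heq (comp v w) (idm y) -> heq (comp w' v') (idm x') ->
  heq (comp b v) (comp v' a) -> heq (comp a w) (comp w' b).
Proof.
move=> vw wv' ab.
apply: heq_trans (comp_heq (heq_sym (comp1m a)) (heq_refl w)) _.
apply: heq_trans (comp_heq (comp_heq (heq_sym wv') (heq_refl a)) (heq_refl w)) _.
apply: heq_trans (comp_heq (heq_sym (compA w' v' a)) (heq_refl w)) _.
apply: heq_trans (comp_heq (comp_heq (heq_refl w') (heq_sym ab)) (heq_refl w)) _.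
apply: heq_trans (comp_heq (compA w' b v) (heq_refl w)) _.
apply: heq_trans (heq_sym (compA _ v w)) _.
exact: heq_trans (comp_heq (heq_refl _) vw) (compm1 _).
Qed.

End Isomorphisms.

Section Functors.
Variables C D : category.

Lemma fhom_iso (T : functor C D) (x y : C) (f : hom x y) :
  is_iso f -> is_iso (fhom T f).
Proof.
move=> [g [gf fg]]; exists (fhom T g); split.
  exact: heq_trans (heq_sym (fhom_comp _ _ _))
    (heq_trans (fhom_heq T gf) (fhom_id _ _)).
exact: heq_trans (heq_sym (fhom_comp _ _ _))
  (heq_trans (fhom_heq T fg) (fhom_id _ _)).
Qed.

Lemma functor_isomorphic (T : functor C D) (x y : C) :
  isomorphic x y -> isomorphic (T x) (T y).
Proof. by move=> [f /(fhom_iso T) Tf]; exists (fhom T f). Qed.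

Definition functor_id : functor C C :=
  @Functor C C id (fun x y f => f) (fun x y f g fg => fg)
    (fun x => heq_refl _) (fun x y z g f => heq_refl _).

End Functors.
Arguments functor_id : clear implicits.

Definition functor_comp (C D E : category) (U : functor D E) (T : functor C D) :
    functor C E :=
  @Functor C E (fun x => U (T x)) (fun x y f => fhom U (fhom T f))
    (fun x y f g fg => fhom_heq U (fhom_heq T fg))
    (fun x => heq_trans (fhom_heq U (fhom_id T x)) (fhom_id U (T x)))
    (fun x y z g f =>
       heq_trans (fhom_heq U (fhom_comp T g f)) (fhom_comp U (fhom T g) (fhom T f))).

Section LocalizationTheory.
Variables (C D : category) (S : forall x y : C, hom x y -> Prop).

Lemma localization_iso (x y : C) (s : hom x y) :
  S s -> @is_iso (localization S) x y (WMap S s).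
Proof. by move=> Ss; exists (WInv Ss); split; [exact: WE_invl|exact: WE_invr]. Qed.

(** Words are built from maps and formal inverses, so induction on the word reduces naturality to
    maps of [C]. Families defined on complexes thus become natural on the derived category. *)
Lemma localization_natural (T U : functor (localization S) D)
    (a : forall x : C, hom (T x) (U x)) :
  (forall (x y : C) (f : hom x y),
     heq (comp (a y) (fhom T (WMap S f : @hom (localization S) x y)))
         (comp (fhom U (WMap S f : @hom (localization S) x y)) (a x))) ->
  forall (x y : localization S) (w : hom x y),
    heq (comp (a y) (fhom T w)) (comp (fhom U w) (a x)).
Proof.
move=> nat_a x y; elim=> {x y} [x y f|x y s Ss|x y z g IHg f IHf].
- exact: nat_a.
- pose v : @hom (localization S) x y := WMap S s.
  pose w : @hom (localization S) y x := WInv Ss.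
  have vw : heq (comp v w) (idm (y : localization S)) by exact: WE_invr.
  have wv : heq (comp w v) (idm (x : localization S)) by exact: WE_invl.
  apply: square_inverse (nat_a x y s).
    exact: heq_trans (heq_sym (fhom_comp T v w))
      (heq_trans (fhom_heq T vw) (fhom_id T _)).
  exact: heq_trans (heq_sym (fhom_comp U w v))
    (heq_trans (fhom_heq U wv) (fhom_id U _)).
pose f' : @hom (localization S) x y := f.
pose g' : @hom (localization S) y z := g.
have TC := fhom_comp T g' f'; have UC := fhom_comp U g' f'.
apply: heq_trans (comp_heq (heq_refl _) TC) _.
apply: heq_trans (compA _ _ _) _.
apply: heq_trans (comp_heq IHg (heq_refl _)) _.
apply: heq_trans (heq_sym (compA _ _ _)) _.
apply: heq_trans (comp_heq (heq_refl _) IHf) _.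
apply: heq_trans (compA _ _ _) _.
exact: comp_heq (heq_sym UC) (heq_refl _).
Qed.

Section Lift.
Variable T : functor C D.
Hypothesis T_iso : forall (x y : C) (s : hom x y), S s -> is_iso (fhom T s).

(** The universal property of the localization: a formal inverse goes to a chosen inverse of
    [fhom T s], which [T_iso] provides. *)
Fixpoint lift_word (x y : C) (w : word S x y) : hom (T x) (T y) :=
  match w in word _ x y return hom (T x) (T y) with
  | WMap _ _ f => fhom T f
  | WInv _ _ _ Ss => sval (cid (T_iso Ss))
  | WComp _ _ _ g f => comp (lift_word g) (lift_word f)
  end.

Lemma lift_word_eq (x y : C) (v w : word S x y) :
  word_eq v w -> heq (lift_word v) (lift_word w).
Proof.
elim=> {x y v w} /=.
- by move=> *; exact: heq_refl.
- by move=> *; exact: heq_sym.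
- by move=> x y f g h _ fg _ gh; exact: heq_trans fg gh.
- by move=> *; exact: comp_heq.
- by move=> *; exact: compA.
- move=> x y f; apply: heq_trans (comp1m _).
  by apply: comp_heq (heq_refl _); exact: fhom_id.
- move=> x y f; apply: heq_trans (compm1 _).
  by apply: comp_heq (heq_refl _) _; exact: fhom_id.
- by move=> x y f g fg; exact: fhom_heq.
- by move=> x y z g f; exact: fhom_comp.
- move=> x y s Ss; case: (cid _) => g [gs sg] /=.
  by apply: heq_trans gs _; apply: heq_sym; exact: fhom_id.
- move=> x y s Ss; case: (cid _) => g [gs sg] /=.
  by apply: heq_trans sg _; apply: heq_sym; exact: fhom_id.
Qed.

Definition localization_lift : functor (localization S) D :=
  @Functor (localization S) D T lift_word lift_word_eq
    (fun x => fhom_id T x) (fun x y z g f => heq_refl _).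

End Lift.
End LocalizationTheory.

(** [L] is a left adjoint of [M] with counit [eps], [rho] is the inverse of the
    unit, and the last hypothesis is a triangle identity. *)
Lemma reflective_fully_faithful (C D : category) (L : functor C D)
    (M : functor D C) (rho : forall x : C, hom (M (L x)) x)
    (eps : forall y : D, hom (L (M y)) y) :
  (forall (x y : C) (f : hom x y),
     heq (comp (rho y) (fhom M (fhom L f))) (comp f (rho x))) ->
  (forall (x y : D) (f : hom x y),
     heq (comp (eps y) (fhom L (fhom M f))) (comp f (eps x))) ->
  (forall x : C, is_iso (rho x)) ->
  (forall x : C, heq (eps (L x)) (fhom L (rho x))) ->
  fully_faithful L.
Proof.
move=> nat_rho nat_eps rho_iso triangle; split=> [x y f g fg|x y h].
  apply: (iso_cancel (rho_iso x)).
  apply: heq_trans (heq_sym (nat_rho _ _ f)) _.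
  apply: heq_trans (nat_rho _ _ g).
  exact: comp_heq (heq_refl _) (fhom_heq M fg).
have [r [r_rho rho_r]] := rho_iso x.
(* The preimage is [M h], carried along [rho] at both ends. It is compared with [h] after
   composition with the isomorphism [L (rho x)], where naturality of [eps] and the triangle identity
   apply. *)
exists (comp (comp (rho y) (fhom M h)) r).
apply: (iso_cancel (fhom_iso L (rho_iso x))).
apply: heq_trans (heq_sym (fhom_comp _ _ _)) _.
apply: (@heq_trans _ _ _ _ (fhom L (comp (rho y) (fhom M h)))).
  apply: fhom_heq; apply: heq_trans (heq_sym (compA _ _ _)) _.
  exact: heq_trans (comp_heq (heq_refl _) r_rho) (compm1 _).
apply: heq_trans (fhom_comp _ _ _) _.
apply: heq_trans (comp_heq (heq_sym (triangle _)) (heq_refl _)) _.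
apply: heq_trans (nat_eps _ _ h) _.
exact: comp_heq (heq_refl _) (triangle _).
Qed.

Lemma restrict_fully_faithful (C D : category) (P : C -> Prop) (Q : D -> Prop)
    (T : functor C D) (PQ : forall x, P x -> Q (T x)) :
  fully_faithful T -> fully_faithful (restrict_functor PQ).
Proof.
by move=> [faith full]; split=> [x y f g|x y h]; [exact: faith|exact: full].
Qed.

(** * Inverse image and extension by zero *)

(** Stated at a single point, since the counit is known to be bijective only on the stalks over the
    range of [f]. *)
Lemma quasi_iso_bij_at (k : fieldType) (X : topologicalType) (F G : complex k X)
    (f : complex_map F G) (x : X) : (forall n, bijective (f n x)) -> forall n,
  (forall e : F n x, cdiff F n (n + 1) x e = 0 ->
    (exists w, f n x e = cdiff G (n - 1) n x w) ->
    exists w, e = cdiff F (n - 1) n x w) /\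
  (forall e : G n x, cdiff G n (n + 1) x e = 0 ->
    exists2 e', cdiff F n (n + 1) x e' = 0 &
      exists w, f n x e' - e = cdiff G (n - 1) n x w).
Proof.
move=> fbij n; split=> e de.
  move=> [w ew]; have [g fK gK] := fbij (n - 1); exists (g w).
  by apply: (bij_inj (fbij n)); rewrite ew map_diff gK.
have [g fK gK] := fbij n; exists (g e).
  apply: (bij_inj (fbij (n + 1))); rewrite map_diff gK de; exact/esym/linear0.
by exists 0; rewrite gK subrr linear0.
Qed.

Lemma quasi_iso_bij (k : fieldType) (X : topologicalType) (F G : complex k X)
    (f : complex_map F G) :
  (forall n x, bijective (f n x)) -> quasi_iso f.
Proof.
by move=> fbij; apply/quasi_isoP => n x; apply: quasi_iso_bij_at => m.
Qed.

Lemma quasi_iso_isomorphic (k : fieldType) (X : topologicalType)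
    (F G : Db k X) (f : complex_map F G) : quasi_iso f -> isomorphic F G.
Proof.
by move=> qf; exists (WMap _ (f : @hom (Cb k X) F G)); exact: localization_iso.
Qed.

Section PullbackComp.
Variables (k : fieldType) (Z Y X : topologicalType) (g : Z -> Y) (f : Y -> X).
Hypotheses (g_cont : continuous g) (f_cont : continuous f).
Hypothesis fg_cont : continuous (f \o g).

Lemma pullback_comp_section (F : sheaf k X) (z : Z)
    (s : forall z, pullback_sheaf g_cont (pullback_sheaf f_cont F) z) :
  section_at (pullback_sheaf g_cont (pullback_sheaf f_cont F)) z s ->
  section_at (pullback_sheaf fg_cont F) z s.
Proof.
move=> [t [u Fu tu] st]; exists u => //.
by apply: filterS2 st (g_cont tu) => z' -> ->.
Qed.

(** Both stalks at [z] are [F (f (g z))], so the identity is the comparison map. *)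
Definition pullback_comp_hom (F : sheaf k X) :
    sheaf_hom (pullback_sheaf g_cont (pullback_sheaf f_cont F))
              (pullback_sheaf fg_cont F) :=
  @SheafHom k Z (pullback_sheaf g_cont (pullback_sheaf f_cont F))
    (pullback_sheaf fg_cont F)
    (fun z => [the {linear F (f (g z)) -> F (f (g z))} of idfun])
    (@pullback_comp_section F).

Lemma pullback_comp (F : Db k X) :
  isomorphic (pullback k g_cont (pullback k f_cont F)) (pullback k fg_cont F).
Proof.
pose a := @ComplexMap k Z (pullback k g_cont (pullback k f_cont F))
  (pullback k fg_cont F) (fun n => pullback_comp_hom (cterm F n))
  (fun m n z e => erefl).
by apply: (@quasi_iso_isomorphic k Z _ _ a); apply: quasi_iso_bij => n z; exists id.
Qed.

Lemma sheaf_pullback_comp (F : Sh k X) :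
  isomorphic (sheaf_pullback k g_cont (sheaf_pullback k f_cont F))
    (sheaf_pullback k fg_cont F).
Proof.
by exists (pullback_comp_hom F); apply/sheaf_isoP => z; exists id.
Qed.
End PullbackComp.

(** * Unit and counit for an open embedding *)

Section ShriekPullback.
Variables (k : fieldType) (Y X : topologicalType) (f : Y -> X).
Hypothesis f_emb : open_embedding f.
Let f_cont := open_embedding_continuous f_emb.

Section Unit.
Variable F : sheaf k Y.

Definition fibre_eval (y : Y) (e : shriek_stalk f F (f y)) : F y :=
  e (exist _ y erefl).

Lemma fibre_eval_linear y : linear (@fibre_eval y).
Proof. by []. Qed.

HB.instance Definition _ y := GRing.isLinear.Build k (shriek_stalk f F (f y))
  (F y) _ (@fibre_eval y) (@fibre_eval_linear y).

(** The fibre over [f y] is a single point: its elements agree by injectivity of [f], and the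
    equality proofs they carry by proof irrelevance. *)
Lemma fibre_eval_inj y : injective (@fibre_eval y).
Proof.
move=> e e' ee'; apply: functional_extensionality_dep => -[y' yy'] /=.
have y'y := open_embedding_inj f_emb yy'.
case: _ / (esym y'y) yy' => yy'.
by rewrite (Prop_irrelevance yy' erefl) -[LHS]/(fibre_eval e) ee'.
Qed.

Lemma fibre_eval_bij y : bijective (@fibre_eval y).
Proof.
have surj d : exists e, fibre_eval e = d :> F y.
  (* A family [s] through [d] gives values on the whole fibre without transport along an
     equality. *)
  have [s Fs sy] := section_ex d.
  by exists (fun p => s (sval p)).
have /choice[g gK] := surj; exists g => e; last exact: gK.
by apply: fibre_eval_inj; rewrite gK.
Qed.

Lemma fibre_eval_section (y : Y)
    (s : forall y, pullback_sheaf f_cont (shriek_sheaf f_emb F) y) :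
  section_at (pullback_sheaf f_cont (shriek_sheaf f_emb F)) y s ->
  section_at F y (fun y => fibre_eval (s y)).
Proof.
move=> [t [Ft _] st]; apply: section_ext (Ft y erefl) _.
by apply: filterS st => y' ->.
Qed.

Definition unit_inv_hom :
    sheaf_hom (pullback_sheaf f_cont (shriek_sheaf f_emb F)) F :=
  @SheafHom k Y (pullback_sheaf f_cont (shriek_sheaf f_emb F)) F
    (fun y => [the {linear shriek_stalk f F (f y) -> F y} of @fibre_eval y])
    fibre_eval_section.
End Unit.

Definition unit_inv_map (F : complex k Y) :
    complex_map (pullback k f_cont (shriek k f_emb F)) F :=
  @ComplexMap k Y (pullback k f_cont (shriek k f_emb F)) F
    (fun n => unit_inv_hom (F n)) (fun m n y e => erefl).

Definition unit_inv (F : Db k Y) :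
    @hom (Db k Y) (pullback k f_cont (shriek k f_emb F)) F :=
  WMap _ (unit_inv_map F : @hom (Cb k Y) _ _).

Lemma unit_inv_iso (F : Db k Y) : is_iso (unit_inv F).
Proof.
apply: localization_iso; apply: quasi_iso_bij => n y.
exact: fibre_eval_bij.
Qed.

Lemma unit_inv_natural (F G : Db k Y) (h : hom F G) :
  heq (comp (unit_inv G) (fhom (pullback k f_cont) (fhom (shriek k f_emb) h)))
      (comp h (unit_inv F)).
Proof.
apply: (@localization_natural (Cb k Y) (Db k Y) _
  (functor_comp (pullback k f_cont) (shriek k f_emb)) (functor_id (Db k Y))
  unit_inv) => {F G h} F G h.
apply: WE_trans (WE_sym (WE_map_comp _ _ _)) _.
apply: WE_trans (WE_map_comp _ _ _).
by apply: WE_map => n y e.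
Qed.

Section Counit.
Variable F : sheaf k X.
Let jjF := shriek_sheaf f_emb (pullback_sheaf f_cont F).

(** If the fibre over [x] is inhabited, the value at a chosen point is transported to [F x];
    otherwise the stalk is zero and so is the value. By injectivity of [f] the choice is harmless,
    see [fibre_valueE]. *)
Definition fibre_value (x : X)
    (e : shriek_stalk f (pullback_sheaf f_cont F) x) : F x :=
  match pselect (exists p : {y : Y | f y = x}, True) with
  | left H => let p := sval (cid H) in
      match proj2_sig p in _ = x' return F x' with erefl => e p end
  | right _ => 0
  end.

Lemma fibre_value_linear x : linear (@fibre_value x).
Proof.
move=> a u v; rewrite /fibre_value; case: pselect => [H|_].
  by cbv zeta; move: (sval _) => [y yx] {H} /=; case: x / yx u v.
by rewrite scaler0 addr0.
Qed.

HB.instance Definition _ x := GRing.isLinear.Build k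
  (shriek_stalk f (pullback_sheaf f_cont F) x) (F x) _
  (@fibre_value x) (@fibre_value_linear x).

Lemma fibre_valueE y (e : shriek_stalk f (pullback_sheaf f_cont F) (f y)) :
  fibre_value e = e (exist (fun y0 => f y0 = f y) y erefl).
Proof.
rewrite /fibre_value; case: pselect => [H|[]]; last first.
  by exists (exist (fun y0 => f y0 = f y) y erefl).
set p := sval _; case: p => y' yy' /=.
have y'y := open_embedding_inj f_emb yy'.
case: _ / (esym y'y) yy' => yy'.
by rewrite (Prop_irrelevance yy' erefl).
Qed.

Lemma fibre_value_section (x : X) (s : forall x, jjF x) :
  section_at jjF x s -> section_at F x (fun x => fibre_value (s x)).
Proof.
move=> [Fs s0]; have [[y _ yx]|xf] := pselect (range f x).
  have [t] := Fs y yx; rewrite yx => Ft /(open_embedding_near f_emb).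
  rewrite yx => st; apply: section_ext Ft _.
  by apply: filterS st => _ [y' <- st]; rewrite fibre_valueE -st.
apply: section_ext (section_at0 F x) _.
by apply: filterS (s0 xf) => x' ->; rewrite linear0.
Qed.

Definition counit_hom : sheaf_hom jjF F :=
  @SheafHom k X jjF F (fun x =>
    [the {linear shriek_stalk f (pullback_sheaf f_cont F) x -> F x}
     of @fibre_value x]) fibre_value_section.
End Counit.

Lemma fibre_value_map (F G : sheaf k X) (h : sheaf_hom F G) x
    (e : shriek_stalk f (pullback_sheaf f_cont F) x) :
  fibre_value (shriek_map (pullback_hom f_cont h) e) = h x (fibre_value e).
Proof.
have [[y _ yx]|xf] := pselect (range f x).
  by case: x / yx e => e; rewrite !fibre_valueE.
rewrite /fibre_value; case: pselect => [H|_]; last by rewrite linear0.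
by case: xf; have [[y yx] _] := H; exists y.
Qed.

Lemma counit_map_diff (F : complex k X) m n x
    (e : shriek k f_emb (pullback k f_cont F) m x) :
  counit_hom (F n) x (cdiff (shriek k f_emb (pullback k f_cont F)) m n x e) =
  cdiff F m n x (counit_hom (F m) x e).
Proof. exact: fibre_value_map. Qed.

Definition counit_map (F : complex k X) :
    complex_map (shriek k f_emb (pullback k f_cont F)) F :=
  ComplexMap (@counit_map_diff F).

Definition counit (F : Db k X) :
    @hom (Db k X) (shriek k f_emb (pullback k f_cont F)) F :=
  WMap _ (counit_map F : @hom (Cb k X) _ _).

Lemma counit_natural (F G : Db k X) (h : hom F G) :
  heq (comp (counit G) (fhom (shriek k f_emb) (fhom (pullback k f_cont) h)))
      (comp h (counit F)).
Proof.
apply: (@localization_natural (Cb k X) (Db k X) _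
  (functor_comp (shriek k f_emb) (pullback k f_cont)) (functor_id (Db k X))
  counit) => {F G h} F G h.
apply: WE_trans (WE_sym (WE_map_comp _ _ _)) _.
apply: WE_trans (WE_map_comp _ _ _).
by apply: WE_map => n y e; exact: fibre_value_map.
Qed.

(** The triangle identity: both sides evaluate at the only point of the fibre. *)
Lemma counit_shriek (F : Db k Y) :
  heq (counit (shriek k f_emb F)) (fhom (shriek k f_emb) (unit_inv F)).
Proof.
apply: WE_map => n x e; apply: functional_extensionality_dep => -[y yx].
by case: x / yx e => e /=; rewrite fibre_valueE.
Qed.

Lemma shriek_fully_faithful : fully_faithful (shriek k f_emb).
Proof.
apply: (reflective_fully_faithful unit_inv_natural counit_natural).
  exact: unit_inv_iso.
exact: counit_shriek.
Qed.

(** Since [g] factors as [f \o h], the unit cancels [f^-1 f_!]. This computes [f_!] along any map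
    into the range of [f]. *)
Lemma pullback_shriek (Z : topologicalType) (h : Z -> Y) (h_cont : continuous h)
    (g : Z -> X) (g_cont : continuous g) (F : Db k Y) :
  (forall z, f (h z) = g z) ->
  isomorphic (pullback k g_cont (shriek k f_emb F)) (pullback k h_cont F).
Proof.
move=> /funext fh; case: g / fh g_cont => fh_cont.
apply: isomorphic_trans (isomorphic_sym (pullback_comp h_cont f_cont _ _)) _.
apply: functor_isomorphic; exists (unit_inv F); exact: unit_inv_iso.
Qed.

(** Over the range the counit is bijective on stalks; elsewhere its source has zero stalks, and
    acyclicity of [F] there is exactly what remains. *)
Lemma counit_isomorphic (F : Db k X) :
  (forall n x, ~ range f x -> forall e : cterm F n x,
     cdiff F n (n + 1) x e = 0 -> exists w, e = cdiff F (n - 1) n x w) ->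
  isomorphic (shriek k f_emb (pullback k f_cont F)) F.
Proof.
move=> F0; apply: (@quasi_iso_isomorphic k X _ _ (counit_map F)).
apply/quasi_isoP => n x; have [[y _ yx]|xf] := pselect (range f x).
  case: x / yx; apply: quasi_iso_bij_at => m.
  have [g gK Kg] := fibre_eval_bij (pullback_sheaf f_cont (F m)) y.
  by exists g => e; rewrite /= fibre_valueE; [exact: gK|exact: Kg].
split=> e de.
  move=> _; exists 0; rewrite linear0; apply: functional_extensionality_dep => -[y yx].
  by case: xf; exists y.
exists 0; first exact: linear0.
have [w ew] := F0 n x xf e de.
by exists (- w); rewrite linear0 sub0r linearN ew.
Qed.
End ShriekPullback.

(** * Cohomology, zero objects, constant objects *)

Section CohomologyFunctor.
Variables (k : fieldType) (X : topologicalType) (n : int).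

Lemma cohomology_map_heq (F G : Cb k X) (f g : hom F G) : heq f g ->
  @heq (Sh k X) _ _ (cohomology_map f n) (cohomology_map g n).
Proof.
move=> fg x c; rewrite -[c]cohomology_reprK.
apply: etrans (cohomology_map_class f _) _.
apply: etrans _ (esym (cohomology_map_class g _)).
by congr cohomology_class; apply: val_inj; exact: fg.
Qed.

Lemma cohomology_map_id (F : Cb k X) :
  @heq (Sh k X) _ _ (cohomology_map (idm F) n) (idm (cohomology F n : Sh k X)).
Proof.
move=> x c; rewrite -[c]cohomology_reprK.
apply: etrans (cohomology_map_class _ _) _.
by congr cohomology_class; apply: val_inj.
Qed.

Lemma cohomology_map_comp (F G H : Cb k X) (g : hom G H) (f : hom F G) :
  @heq (Sh k X) (cohomology F n) (cohomology H n) (cohomology_map (comp g f) n)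
    (@comp (Sh k X) (cohomology F n) (cohomology G n) (cohomology H n)
      (cohomology_map g n) (cohomology_map f n)).
Proof.
move=> x c; rewrite -[c]cohomology_reprK.
apply: etrans (cohomology_map_class _ _) _.
apply: esym; apply: etrans (congr1 _ (cohomology_map_class _ _)) _.
apply: etrans (cohomology_map_class _ _) _.
by congr cohomology_class; apply: val_inj.
Qed.

Definition cohomology_complex : functor (Cb k X) (Sh k X) :=
  @Functor (Cb k X) (Sh k X) (fun F => cohomology F n)
    (fun F G f => cohomology_map f n) cohomology_map_heq cohomology_map_id
    cohomology_map_comp.

(** By definition cohomology inverts quasi-isomorphisms, so it descends to the derived category. It
    turns isomorphisms there, which are mere words, into maps of sheaves. *)
Definition cohomology_functor : functor (Db k X) (Sh k X) :=
  @localization_lift (Cb k X) (Sh k X) (@quasi_iso k X) cohomology_complex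
    (fun F G s qs => qs n).

Lemma cohomology_isomorphic (F G : Db k X) : isomorphic F G ->
  @isomorphic (Sh k X) (cohomology F n) (cohomology G n).
Proof. exact: (functor_isomorphic cohomology_functor). Qed.

End CohomologyFunctor.

Section CohomologyPullback.
Variables (k : fieldType) (Y X : topologicalType) (f : Y -> X).
Hypothesis f_cont : continuous f.
Variables (F : Db k X) (n : int).

Lemma cohomology_pullback_section (y : Y)
    (s : forall y, pullback_sheaf f_cont (cohomology F n) y) :
  section_at (pullback_sheaf f_cont (cohomology F n)) y s ->
  section_at (cohomology (pullback k f_cont F) n) y s.
Proof.
move=> [t [u Fu /f_cont tu] st]; exists (fun y => u (f y)).
  by exists u => //; exact: nearW.
by apply: filterS2 st tu => y' -> [z zu tz]; exists z.
Qed.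

(** Cohomology is computed stalkwise, so both sides have the same stalks and the identity is the
    comparison map. *)
Lemma cohomology_pullback :
  isomorphic (sheaf_pullback k f_cont (cohomology F n))
    (cohomology (pullback k f_cont F) n : Sh k Y).
Proof.
exists (@SheafHom k Y (pullback_sheaf f_cont (cohomology F n))
  (cohomology (pullback k f_cont F) n)
  (fun y => [the {linear cohomology F n (f y) -> cohomology F n (f y)} of idfun])
  cohomology_pullback_section).
by apply/sheaf_isoP => y; exists id.
Qed.
End CohomologyPullback.

Lemma cohomology_mod0 (k : fieldType) (L M N : lmodType k)
    (d' : {linear L -> M}) (d : {linear M -> N}) :
  (forall e : M, e = 0) -> forall c : cohomology_mod d' d, c = 0.
Proof.
move=> M0 c; rewrite -[c]cohomology_reprK; apply/cohomology_class_eq0.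
by exists 0; rewrite linear0; exact: M0.
Qed.

Section Zero.
Variables (k : fieldType) (X : topologicalType).

Lemma zero_terms_is_zero (F : Db k X) :
  (forall n x (e : cterm F n x), e = 0) -> is_zero F.
Proof.
move=> F0; pose a n x (e : cterm F n x) : zero_complex k X n x := 0.
have a_lin n x : linear (@a n x) by move=> c u v; rewrite /a scaler0 addr0.
pose al n x : {linear cterm F n x -> zero_complex k X n x} :=
  HB.pack (@a n x) (GRing.isLinear.Build k _ _ _ (@a n x) (@a_lin n x)).
pose f n : sheaf_hom (cterm F n) (zero_complex k X n) :=
  @SheafHom k X (cterm F n) (zero_complex k X n) (al n) (fun x s Fs => I).
have f_diff m n x (e : cterm F m x) :
    f n x (cdiff F m n x e) = cdiff (zero_complex k X) m n x (f m x e).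
  exact/esym/thinmx0.
apply: (@quasi_iso_isomorphic k X F (zero_complex k X : Db k X) (ComplexMap f_diff)).
apply: quasi_iso_bij => n x; exists (fun=> 0) => e; first exact/esym/F0.
exact/esym/thinmx0.
Qed.

(** Cohomology turns the isomorphism with zero into an injection of each cohomology stalk into a
    zero module. *)
Lemma is_zero_acyclic (F : Db k X) : is_zero F -> forall n x (e : cterm F n x),
  cdiff F n (n + 1) x e = 0 -> exists w, e = cdiff F (n - 1) n x w.
Proof.
move=> F0 n x e /eqP de.
have [f /sheaf_isoP/(_ x)/bij_inj finj] := cohomology_isomorphic n F0.
pose z : cocycle (cdiff F n (n + 1) x) := Sub e de.
have /cohomology_class_eq0[w] : cohomology_class (cdiff F (n - 1) n x) z = 0.
  by apply: finj; rewrite linear0; apply: cohomology_mod0 => u; exact: thinmx0.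
by rewrite SubK => ew; exists w.
Qed.
End Zero.

Lemma zero_finite_dimensional (k : fieldType) (M : lmodType k) :
  (forall e : M, e = 0) -> finite_dimensional M.
Proof.
move=> M0; pose a (e : M) : 'rV[k]_0 := 0.
have a_lin : linear a by move=> c u v; rewrite /a scaler0 addr0.
pose al : {linear M -> 'rV[k]_0} := HB.pack a (GRing.isLinear.Build k _ _ _ a a_lin).
exists 0, al, (fun=> 0) => e; first exact/esym/M0.
exact/esym/thinmx0.
Qed.

Section ConstantTheory.
Variables (k : fieldType) (X : topologicalType).

Lemma constant_isomorphic (F G : Db k X) : isomorphic F G ->
  constant_finite_rank G -> constant_finite_rank F.
Proof. by move=> FG [L Lfin GL]; exists L => //; exact: isomorphic_trans FG GL. Qed.

Lemma constant_pullback (Z : topologicalType) (g : Z -> X) (g_cont : continuous g)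
    (F : Db k X) :
  constant_finite_rank F -> constant_finite_rank (pullback k g_cont F).
Proof.
move=> [L Lfin FL]; exists L => //.
apply: isomorphic_trans (functor_isomorphic _ FL) _.
exact: pullback_comp.
Qed.

Lemma constant_zero (F : Db k X) : is_zero F -> constant_finite_rank F.
Proof.
move=> F0; exists (zero_complex k point_space) => [n|].
  apply: zero_finite_dimensional; apply: cohomology_mod0 => u; exact: thinmx0.
apply: isomorphic_trans F0 (isomorphic_sym _).
by apply: zero_terms_is_zero => n x e; exact: thinmx0.
Qed.

Lemma constant_cohomology (F : Db k X) (n : int) : constant_finite_rank F ->
  constant_sheaf_finite_rank (cohomology F n : Sh k X).
Proof.
move=> [L Lfin FL]; exists (cohomology L n); first exact: Lfin.
apply: isomorphic_trans (cohomology_isomorphic n FL) _.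
exact: isomorphic_sym (cohomology_pullback _ _ _).
Qed.

Lemma constant_sheaf_isomorphic (F G : Sh k X) : isomorphic F G ->
  constant_sheaf_finite_rank G -> constant_sheaf_finite_rank F.
Proof. by move=> FG [L Lfin GL]; exists L => //; exact: isomorphic_trans FG GL. Qed.

Lemma constant_locally_constant (F : Sh k X) :
  constant_sheaf_finite_rank F -> locally_constant_finite_rank F.
Proof.
move=> [L Lfin FL] x; exists setT; split=> //; first exact: openT.
exists L => //; apply: isomorphic_trans (functor_isomorphic _ FL) _.
exact: sheaf_pullback_comp.
Qed.
End ConstantTheory.

(** * Half-cones *)

Lemma subspace_continuous (Z X : topologicalType) (A : set X) (g : Z -> A) :
  continuous (fun z => set_val (g z)) -> continuous g.
Proof.
move=> gc; apply/continuousP => _ [D openD <-]; rewrite -comp_preimage.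
by move/continuousP: gc; exact.
Qed.

(** The map [g] factors through the subspace [A], and inverse images preserve constant objects. *)
Lemma constant_restriction (k : fieldType) (Z X : topologicalType) (A : set X)
    (g : Z -> X) (g_cont : continuous g) (F : Db k X) :
  (forall z, A (g z)) -> constant_finite_rank (restriction k A F) ->
  constant_finite_rank (pullback k g_cont F).
Proof.
move=> Ag FA; pose q z : A := exist _ (g z) (mem_set (Ag z)).
have q_cont : continuous q by exact: subspace_continuous.
apply: constant_isomorphic (constant_pullback q_cont FA).
exact: isomorphic_sym (pullback_comp _ _ _ _).
Qed.

Lemma open_embedding_lift_continuous (Z Y X : topologicalType) (f : Y -> X)
    (h : Z -> Y) : open_embedding f -> continuous (f \o h) -> continuous h.
Proof.
move=> f_emb /continuousP fh; apply/continuousP => U oU.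
rewrite (_ : h @^-1` U = (f \o h) @^-1` (f @` U)).
  exact/fh/(open_embedding_open f_emb).
apply/seteqP; split=> z /=; first by exists (h z).
by move=> [y Uy /(open_embedding_inj f_emb) <-].
Qed.

(** * Polyhedra and coverings indexed by finite types *)

Section PiecewiseLinearTheory.
Variables (R : realType) (E : normedModType R).

Lemma half_space_lt (l : E -> R) (c : R) : scalar l -> (exists v, l v != 0) ->
  half_space [set v | l v < c].
Proof.
move=> ll lv; exists (HB.pack l (GRing.isLinear.Build R E R _ l ll) : {scalar E}), c.
by split=> //; left.
Qed.

Lemma half_space_le (l : E -> R) (c : R) : scalar l -> (exists v, l v != 0) ->
  half_space [set v | l v <= c].
Proof.
move=> ll lv; exists (HB.pack l (GRing.isLinear.Build R E R _ l ll) : {scalar E}), c.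
by split=> //; right.
Qed.

Lemma convex_polyhedron_fin (T : finType) (H : T -> set E) :
  (forall i, half_space (H i)) -> convex_polyhedron [set v | forall i, H i v].
Proof.
move=> HH; exists #|T|, (fun i => H (enum_val i)); split=> //.
apply/seteqP; split=> v /=; first by move=> Hv i _.
by move=> Hv i; have := Hv (enum_rank i) I; rewrite enum_rankK.
Qed.

Lemma PL_fin (k : fieldType) (F : Db k E) (T : finType) (P : T -> set E) :
  (forall a, convex_polyhedron (P a)) -> (forall v, exists a, P a v) ->
  (forall a, constant_finite_rank (restriction k (P a) F)) -> PL F.
Proof.
move=> PP Pcov PF; exists #|T|, (fun i => P (enum_val i)); split=> //.
rewrite -subTset => v _; have [a Pa] := Pcov v.
by exists (enum_rank a) => //; rewrite enum_rankK.
Qed.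
End PiecewiseLinearTheory.

Section Cone.
Variables (R : realType) (V : normedModType R).
Local Notation W := (V * R)%type.

Definition dehomogenize (w : W) : V := w.2^-1 *: w.1.

Definition half_cone (s : R) (P : set V) : set W :=
  [set w | 0 < s * w.2 /\ P (dehomogenize w)].

(** On the half-cone [s * w.2] is positive; multiplying a condition on [l (dehomogenize w)] by it
    clears the denominator and leaves the linear form [f]. *)
Lemma half_cone_polyhedron (s : R) (P : set V) : s != 0 ->
  convex_polyhedron P -> convex_polyhedron (half_cone s P).
Proof.
move=> s0 [n [H [HH ->]]].
have lin2 a : scalar (fun w : W => a * w.2).
  by move=> c u v /=; rewrite mulrDr mulrCA.
have lin2_neq0 a : a != 0 -> exists w : W, a * w.2 != 0.
  by move=> a0; exists (0, 1); rewrite mulr1.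
have H0 : half_space [set w : W | 0 < s * w.2].
  rewrite (_ : mkset _ = [set w : W | - s * w.2 < 0]).
    by apply: half_space_lt => //; apply: lin2_neq0; rewrite oppr_eq0.
  by apply/seteqP; split=> w /=; rewrite mulNr oppr_lt0.
have H1 i : exists L : set W, half_space L /\
    forall w, 0 < s * w.2 -> H i (dehomogenize w) <-> L w.
  have [l [c [[v lv] Hi]]] := HH i.
  pose f (w : W) : R := s * l w.1 - s * c * w.2.
  have lin_f : scalar f.
    move=> a u w; rewrite /f /= linearP /=; rewrite /GRing.scale /=; ring.
  have f_neq0 : exists w, f w != 0.
    by exists (v, 0); rewrite /f /= mulr0 subr0 mulf_neq0.
  have E w : 0 < s * w.2 -> l (dehomogenize w) = (s * l w.1) / (s * w.2).
    move=> sw; have : s * w.2 != 0 by rewrite gt_eqF.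
    rewrite mulf_eq0 negb_or => /andP[_ w2].
    by rewrite linearZ /= invfM mulrACA mulfV // mul1r mulrC.
  case: Hi => ->.
    exists [set w | f w < 0]; split; first exact: half_space_lt.
    move=> w sw; rewrite /= E // ltr_pdivrMr // subr_lt0.
    by rewrite mulrCA mulrA.
  exists [set w | f w <= 0]; split; first exact: half_space_le.
  move=> w sw; rewrite /= E // ler_pdivrMr // subr_le0.
  by rewrite mulrCA mulrA.
have [L HL] := choice H1.
(* The index [None] carries the sign condition. *)
pose K (o : option 'I_n) : set W :=
  if o is Some i then L i else [set w | 0 < s * w.2].
rewrite (_ : half_cone _ _ = [set w | forall o, K o w]).
  by apply: convex_polyhedron_fin => -[i|]; [exact: (HL i).1|].
apply/seteqP; split=> w /=.
  by move=> [sw Hw] [i|//]; apply/(HL i).2 => //; exact: Hw.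
move=> Kw; have sw := Kw None; split=> // i _.
by apply/(HL i).2 => //; exact: (Kw (Some i)).
Qed.

(** An equation is a pair of opposite closed inequalities, indexed here by a sign. *)
Lemma hyperplane_polyhedron : convex_polyhedron [set w : W | w.2 = 0].
Proof.
pose K (b : bool) : set W := [set w | (-1) ^+ b * w.2 <= 0].
rewrite (_ : mkset _ = [set w | forall b, K b w]).
  apply: convex_polyhedron_fin => b; apply: half_space_le.
    by move=> c u v /=; rewrite mulrDr mulrCA.
  by exists (0, 1); rewrite mulr1 signr_eq0.
apply/seteqP; split=> w /=; first by move=> w2 b; rewrite /K /= w2 mulr0.
move=> Kw; apply/eqP; rewrite eq_le.
have := Kw false; rewrite /K /= expr0 mul1r => ->.
by have := Kw true; rewrite /K /= expr1 mulN1r oppr_le0 => ->.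
Qed.

Lemma half_cone_cover (T : Type) (P : T -> set V) (w : W) :
  (forall v, exists a, P a v) ->
  w.2 = 0 \/ exists (b : bool) a, half_cone ((-1) ^+ b) (P a) w.
Proof.
move=> Pcov; have [->|w2] := eqVneq w.2 0; first by left.
(* The bit records the sign of [w.2], so that [(-1) ^+ b * w.2] is its absolute value. *)
right; have [a Pa] := Pcov (dehomogenize w); exists (w.2 < 0), a; split=> //.
by rewrite -[(-1) ^+ _ * _]normrEsign normr_gt0.
Qed.

Local Notation j := (@affine_embed R V).

Lemma affine_embedE (v : V) (w : @punctured R V) :
  j v = to_proj w <->
  (set_val w).2 != 0 /\ v = dehomogenize (set_val w).
Proof.
split=> [/to_proj_eq/asboolP[c c0 ->]|[w2 ->]].
  by rewrite /dehomogenize /= [c *: 1]mulr1 scalerA mulVf// scale1r.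
apply/to_proj_eq/asboolP; exists (set_val w).2 => //.
rewrite [LHS]surjective_pairing; apply/pair_equal_spec; split=> /=.
  by rewrite scalerA mulfV// scale1r.
by rewrite [RHS]mulr1.
Qed.

Variable k : fieldType.
Let j_emb := @affine_embed_open_embedding R V.

(** The inverse image of [j_! F] along [u = j \o h] is that of [F] along [h], and [h] takes its
    values in [P]. *)
Lemma shriek_pullback_constant (Z : topologicalType) (h : Z -> V)
    (u : Z -> proj_space V) (u_cont : continuous u) (P : set V) (F : Db k V) :
  (forall z, j (h z) = u z) -> (forall z, P (h z)) ->
  constant_finite_rank (restriction k P F) ->
  constant_finite_rank (pullback k u_cont (j_shriek V k F)).
Proof.
move=> jh Ph FP; have h_cont : continuous h.
  apply: (open_embedding_lift_continuous j_emb).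
  by rewrite (_ : _ \o _ = u) //; exact/funext.
apply: constant_isomorphic (pullback_shriek j_emb h_cont u_cont F jh) _.
exact: constant_restriction Ph FP.
Qed.

Lemma shriek_pullback_zero (Z : topologicalType)
    (u : Z -> proj_space V) (u_cont : continuous u) (F : Db k V) :
  (forall z, ~ range j (u z)) -> is_zero (pullback k u_cont (j_shriek V k F)).
Proof.
move=> ju; apply: zero_terms_is_zero => n z e.
apply: functional_extensionality_dep => -[v vz].
by case: (ju z); exists v.
Qed.

Lemma PL_cone (F : Db k V) : PL F ->
  PL (shriek k (@punctured_open_embedding R V)
    (pullback k (@to_proj_continuous R V) (j_shriek V k F))).
Proof.
move=> [n [P [PP Pcov PF]]].
have {}Pcov v : exists a, P a v.
  by have : setT v by []; rewrite -Pcov => -[a _ Pa]; exists a.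
pose Q (o : option (bool * 'I_n)) : set W := if o is Some (b, a)
  then half_cone ((-1) ^+ b) (P a) else [set w | w.2 = 0].
apply: (PL_fin (P := Q)).
- move=> [[b a]|] /=; last exact: hyperplane_polyhedron.
  by apply: half_cone_polyhedron (PP a); rewrite signr_eq0.
- move=> w; have [w2|[b [a wa]]] := half_cone_cover w Pcov; first by exists None.
  by exists (Some (b, a)).
(* On the hyperplane [w.2 = 0] all stalks vanish: they are products over fibres of [j], which are
   empty there. *)
move=> [[b a]|] /=; last first.
  apply: constant_zero; apply: zero_terms_is_zero => m z e.
  apply: functional_extensionality_dep => -[w wz].
  apply: functional_extensionality_dep => -[v vw].
  have /affine_embedE[] := vw.
  by rewrite wz (set_mem (svalP z)) eqxx.
have Qw (z : half_cone ((-1) ^+ b) (P a)) :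
    0 < (-1) ^+ b * (set_val z).2 /\ P a (dehomogenize (set_val z)).
  exact: set_mem (svalP z).
have z2 (z : half_cone ((-1) ^+ b) (P a)) : (set_val z).2 != 0.
  by apply/negP => /eqP z2; have := (Qw z).1; rewrite z2 mulr0 ltxx.
have z0 (z : half_cone ((-1) ^+ b) (P a)) : set_val z \in @punctured R V.
  by apply/mem_set; apply/eqP => z0; have := z2 z; rewrite z0 eqxx.
(* The half-cone avoids the origin, so its inclusion lifts to the punctured space. This removes
   [iota_!]; after [pi], the map to the projective space is [j] composed with dehomogenization. *)
pose h z : @punctured R V := exist _ (set_val z) (z0 z).
have h_cont : continuous h.
  by apply: subspace_continuous; exact: set_val_continuous.
apply: constant_isomorphic.
  exact: (pullback_shriek (@punctured_open_embedding R V) h_cont).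
have u_cont : continuous (@to_proj R V \o h).
  by move=> z; apply: continuous_comp; [exact: h_cont|exact: to_proj_continuous].
apply: constant_isomorphic (pullback_comp h_cont _ u_cont _) _.
apply: (shriek_pullback_constant (h := fun z => dehomogenize (set_val z))) (PF a) => z.
  by apply/(affine_embedE _ (h z)); split; [exact: z2|].
exact: (Qw z).2.
Qed.

End Cone.

(** * Semilinear sets are subanalytic *)

Section AffineAnalytic.
Variables (R : realType) (n : nat).
Implicit Types (c : R) (a : 'I_n -> R) (al : 'I_n -> nat).

(** The power series coefficient at [al] of an affine function: [c] at the zero multi-index and
    [a i] at the [i]-th unit one. *)
Definition affine_coef c a al : R :=
  c * [forall j, al j == 0]%:R + \sum_i a i * [forall j, al j == (j == i)]%:R.

(** At each multi-index at most one indicator is nonzero, so the norm passes inside the sum. *)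
Lemma norm_affine_coef c a al :
  `|affine_coef c a al| = affine_coef `|c| (fun i => `|a i|) al.
Proof.
rewrite /affine_coef; case: (boolP [forall j, al j == 0]) => [/forallP al0|_].
  have E i : [forall j, al j == (j == i)] = false.
    by apply/negP => /forallP /(_ i); rewrite eqxx (eqP (al0 i)).
  by rewrite !mulr1 !big1 ?addr0 // => i _; rewrite E mulr0.
rewrite !mulr0 !add0r.
case: (pickP (fun i => [forall j, al j == (j == i)])) => [i /forallP ali|al0].
  have E i' : i' != i -> [forall j, al j == (j == i')] = false.
    move=> i'i; apply/negP => /forallP /(_ i).
    by rewrite (eqP (ali i)) eqxx (eq_sym i) (negbTE i'i).
  have S (b : 'I_n -> R) : \sum_i' b i' * [forall j, al j == (j == i')]%:R = b i.
    rewrite (bigD1 i) //= big1 ?addr0 => [|i' /E ->]; last by rewrite mulr0.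
    by rewrite (_ : [forall j, _]) ?mulr1 //; exact/forallP.
  by rewrite !S.
by rewrite !big1 ?normr0 // => i _; rewrite al0 mulr0.
Qed.

Lemma box_sum_delta (be : 'I_n -> nat) (M : ('I_n -> nat) -> R) N :
  (forall i, (be i < N)%N) ->
  box_sum (fun al => [forall j, al j == be j]%:R * M al) N = M be.
Proof.
move=> beN; pose b : {ffun 'I_n -> 'I_N} := [ffun i => Ordinal (beN i)].
have bE : (fun i => b i : nat) = be by apply/funext => i; rewrite ffunE.
rewrite /box_sum (bigD1 b) //= big1 => [|al alb].
  rewrite bE addr0 (_ : [forall j, _]) ?mul1r //.
  by apply/forallP => j; rewrite -bE.
rewrite (_ : [forall j, _] = false) ?mul0r //; apply/negbTE; move: alb.
apply: contra => /forallP alE; apply/eqP/ffunP => i; apply: val_inj.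
by rewrite ffunE /= (eqP (alE i)).
Qed.

(** A box of side at least 2 contains the zero and unit multi-indices, so these sums no longer
    depend on [N]. *)
Lemma box_sum_affine c a (M : ('I_n -> nat) -> R) N :
  box_sum (fun al => affine_coef c a al * M al) N.+2 =
  c * M (fun=> 0) + \sum_i a i * M (fun j => (j == i)).
Proof.
rewrite -(@box_sum_delta (fun=> 0) M N.+2) // mulr_sumr.
under [X in _ = _ + X]eq_bigr => i _.
  rewrite -(@box_sum_delta (fun j => (j == i)) M N.+2); last first.
    by move=> j; case: (j == i).
  rewrite mulr_sumr; over.
rewrite exchange_big -big_split; apply: eq_bigr => al _ /=.
rewrite /affine_coef mulrDl mulr_suml mulrA; congr (_ + _).
by apply: eq_bigr => i _; rewrite mulrA.
Qed.

Lemma affine_analytic (f : 'rV[R]_n -> R) c a (p : 'rV[R]_n) :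
  (forall x, f x = c + \sum_i a i * x 0 i) -> analytic_at f p.
Proof.
(* Expanding at [p] replaces the constant term by [f p] and keeps the slopes. The partial sums are
   eventually constant, so the radius 1 will do. *)
move=> fE; exists (affine_coef (f p) a), 1; split=> [|/=|x _].
- by [].
- rewrite (_ : box_sum _ =
    box_sum (fun al => affine_coef `|f p| (fun i => `|a i|) al * 1)).
    apply: (@is_cvg_near_cst _ _ (`|f p| * 1 + \sum_i `|a i| * 1)).
    by exists 2 => // -[|[|N]] //= _; exact: box_sum_affine.
  by apply/funext => N; apply: eq_bigr => al _; rewrite norm_affine_coef expr1n.
apply: cvg_near_cst; exists 2 => // -[|[|N]] //= _.
rewrite box_sum_affine big1 ?mulr1 // fE [RHS]fE -addrA -big_split /=.
congr (_ + _); apply: eq_bigr => i _.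
rewrite (bigD1 i) //= eqxx expr1 big1 => [|j /negbTE ->]; last exact: expr0.
by rewrite mulr1 mulrBr addrC subrK.
Qed.
End AffineAnalytic.

Section Semilinear.
Variables (R : realType) (m : nat).

Local Notation affine_form := (R * 'rV[R]_m)%type.

Definition form_val (f : affine_form) (x : 'rV[R]_m) : R :=
  f.1 + \sum_i f.2 0 i * x 0 i.

(** [(f, true)] and [(f, false)] stand for [0 < f] and [f = 0]. *)
Definition sat (x : 'rV[R]_m) (q : affine_form * bool) : bool :=
  if q.2 then 0 < form_val q.1 x else form_val q.1 x == 0.

(** A disjunctive normal form: the outer list is a union, each inner list an intersection of atomic
    conditions. *)
Definition semilinear (S : set 'rV[R]_m) : Prop :=
  exists s : seq (seq (affine_form * bool)),
    forall x, S x <-> has (all (sat x)) s.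

Lemma semilinearT : semilinear setT.
Proof. by exists [:: [::]]. Qed.

(** By distributivity, every clause of one form is concatenated with every clause of the other. *)
Lemma semilinearI A B : semilinear A -> semilinear B -> semilinear (A `&` B).
Proof.
move=> [s As] [t Bt]; exists [seq c ++ d | c <- s, d <- t] => x.
rewrite (_ : has _ _ = has (all (sat x)) s && has (all (sat x)) t).
  by rewrite /setI /=; split=> [[/As -> /Bt ->]|/andP[/As ? /Bt ?]].
elim: s {As} => //= c s IHs; rewrite has_cat IHs andb_orl; congr (_ || _).
rewrite has_map; elim: t {Bt IHs} => /= [|d t IHt]; first by rewrite andbF.
by rewrite IHt all_cat andb_orr.
Qed.

Lemma semilinearU A B : semilinear A -> semilinear B -> semilinear (A `|` B).
Proof.
move=> [s As] [t Bt]; exists (s ++ t) => x; rewrite has_cat /setU /=.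
by split=> [[/As ->//|/Bt ->]|/orP[/As|/Bt]]; [rewrite orbT|left|right].
Qed.

Lemma semilinear_forall (T : finType) (A : T -> set 'rV[R]_m) :
  (forall i, semilinear (A i)) -> semilinear [set x | forall i, A i x].
Proof.
move=> HA; suff H (r : seq T) : semilinear [set x | forall i, i \in r -> A i x].
  rewrite (_ : mkset _ = [set x | forall i, i \in enum T -> A i x]) //.
  by apply/seteqP; split=> x /= Ax i; [|apply: Ax; rewrite mem_enum].
elim: r => [|i r IHr].
  by rewrite (_ : mkset _ = setT); [exact: semilinearT|rewrite -subTset].
rewrite (_ : mkset _ = A i `&` [set x | forall i, i \in r -> A i x]).
  exact: semilinearI.
apply/seteqP; split=> x /=.
  by move=> Ax; split=> [|i' i'r]; apply: Ax; rewrite inE ?eqxx ?i'r ?orbT.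
by move=> [Ai Ar] i'; rewrite inE => /predU1P[->//|]; exact: Ar.
Qed.

Definition affine_fun (g : 'rV[R]_m -> R) : Prop :=
  exists f : affine_form, g =1 form_val f.

Lemma affine_fun_scalar (l : 'rV[R]_m -> R) (c : R) : scalar l ->
  affine_fun (fun x => c + l x).
Proof.
move=> lin_l.
pose L : {scalar 'rV[R]_m} := HB.pack l (GRing.isLinear.Build R 'rV[R]_m R _ l lin_l).
exists (c, \row_i l 'e_i) => x; congr (_ + _).
rewrite -[LHS]/(L x) [in LHS](row_sum_delta x) linear_sum; apply: eq_bigr => i _.
by rewrite linearZ /= mxE mulrC.
Qed.

Lemma affine_funN g : affine_fun g -> affine_fun (fun x => - g x).
Proof.
move=> [f gf]; exists (- f.1, - f.2) => x; rewrite gf opprD; congr (_ + _).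
by rewrite -sumrN; apply: eq_bigr => i _; rewrite mxE mulNr.
Qed.

Lemma affine_funB g c : affine_fun g -> affine_fun (fun x => g x - c).
Proof.
move=> [f gf]; exists (f.1 - c, f.2) => x.
by rewrite gf /form_val addrAC.
Qed.

Lemma semilinear_eq0 g : affine_fun g -> semilinear [set x | g x = 0].
Proof.
move=> [f gf]; exists [:: [:: (f, false)]] => x.
by rewrite /= gf andbT orbF; split=> /eqP.
Qed.

Lemma semilinear_gt0 g : affine_fun g -> semilinear [set x | 0 < g x].
Proof.
by move=> [f gf]; exists [:: [:: (f, true)]] => x; rewrite /= gf andbT orbF.
Qed.

Lemma semilinear_lt g c : affine_fun g -> semilinear [set x | g x < c].
Proof.
move=> /(affine_funB c)/affine_funN/semilinear_gt0; congr (semilinear _).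
by apply/seteqP; split=> x /=; rewrite opprB subr_gt0.
Qed.

Lemma semilinear_le g c : affine_fun g -> semilinear [set x | g x <= c].
Proof.
move=> ag; have := semilinearU (semilinear_lt c ag) (semilinear_eq0 (affine_funB c ag)).
congr (semilinear _); apply/seteqP; split=> x /=.
  by move=> [/ltW //|/eqP]; rewrite subr_eq0 => /eqP ->.
by rewrite le_eqVlt => /predU1P[->|]; [right; rewrite subrr|left].
Qed.

(** Balls of row vectors are products of intervals. They serve below to make a semilinear set
    bounded. *)
Lemma semilinear_ball (a : 'rV[R]_m) (r : R) : 0 < r -> semilinear (ball a r).
Proof.
move=> r0.
have al i : affine_fun (fun x => x 0 i).
  have [|f fE] := @affine_fun_scalar (fun x => x 0 i) 0.
    by move=> c u v; rewrite !mxE.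
  by exists f => x; rewrite -fE add0r.
have : semilinear [set x | forall i, a 0 i - r < x 0 i < a 0 i + r].
  apply: semilinear_forall => i.
  have := semilinearI (semilinear_lt (- (a 0 i - r)) (affine_funN (al i)))
    (semilinear_lt (a 0 i + r) (al i)).
  congr (semilinear _); apply/seteqP; split=> x /=; rewrite ltrN2.
    by move=> [-> ->].
  by move=> /andP.
congr (semilinear _); apply/seteqP; split=> x /=.
  by move=> xa; split=> // i i'; rewrite ord1 ball_itv /= in_itv; exact: xa.
by move=> [_ xa] i; have := xa 0 i; rewrite ball_itv /= in_itv.
Qed.

Lemma semilinear_semianalytic S : semilinear S -> semianalytic S.
Proof.
move=> [s Ss] a; exists setT; split=> //; first exact: openT.
pose q := (\max_(c <- s) size c)%N.
(* The condition [0 < 1], which always holds, pads all clauses to the common length [q], since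
   [semianalytic] asks for a rectangular array. *)
pose dflt : affine_form * bool := ((1, 0), true).
have sat_dflt x : sat x dflt.
  by rewrite /sat /form_val /= big1 ?addr0 // => i _; rewrite mxE mul0r.
pose cond (i : 'I_(size s)) (j : 'I_q) := nth dflt (nth [::] s i) j.
exists (size s), q, (fun i j => form_val (cond i j).1), (fun i j => (cond i j).2).
split=> [i j x _|x _]; first exact: affine_analytic.
rewrite Ss; split=> [/(has_nthP [::])[i si /(all_nthP dflt) sc]|[i sc]].
  exists (Ordinal si) => j; rewrite -/(sat x (cond _ j)) /cond /=.
  have [/sc //|js] := ltnP j (size (nth [::] s i)); by rewrite nth_default.
apply/(has_nthP [::]); exists i => //; apply/(all_nthP dflt) => j js.
have jq : (j < q)%N.
  by apply: leq_trans js _; apply: (leq_bigmax_seq (F := size)) => //; exact: mem_nth.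
exact: (sc (Ordinal jq)).
Qed.
End Semilinear.

Lemma semilinear_lsubmx (R : realType) (n p : nat) (A : set 'rV[R]_n) :
  semilinear A -> semilinear [set z : 'rV[R]_(n + p) | A (lsubmx z)].
Proof.
move=> [s As].
pose lift (q : (R * 'rV[R]_n) * bool) := ((q.1.1, row_mx q.1.2 (0 : 'rV[R]_p)), q.2).
have lift_sat z q : sat z (lift q) = sat (lsubmx z) q.
  rewrite /sat /= (_ : form_val _ z = form_val q.1 (lsubmx z)) //.
  rewrite /form_val big_split_ord /= [X in _ + (_ + X)]big1 ?addr0 => [|i _].
    by congr (_ + _); apply: eq_bigr => i _; rewrite row_mxEl mxE.
  by rewrite row_mxEr mxE mul0r.
exists (map (map lift) s) => z /=; rewrite As has_map.
suff -> : has (all (sat (lsubmx z))) s = has (preim (map lift) (all (sat z))) s by [].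
by apply: eq_has => c /=; rewrite all_map; apply: eq_all => q /=; rewrite lift_sat.
Qed.

Lemma semilinear_subanalytic (R : realType) (n : nat) (A : set 'rV[R]_n) :
  semilinear A -> subanalytic A.
Proof.
move=> sA a; exists (ball a 1); split; [exact: ball_open|exact: ballxx|].
pose c : 'rV[R]_(n + 0) := row_mx a 0.
(* No coordinate is projected away; intersecting with a ball around [a] makes the set bounded
   without changing it near [a]. *)
exists 0, (ball c 1 `&` [set z | A (lsubmx z)]); split.
- apply: semilinear_semianalytic; apply: semilinearI; first exact: semilinear_ball.
  exact: semilinear_lsubmx.
- exists (`|c| + 1); split; first exact: num_real.
  move=> M cM z [+ _] /=; rewrite -ball_normE /= => cz.
  rewrite -[z](subKr c) (le_trans (ler_normB _ _)) //.
  by rewrite (le_trans _ (ltW cM)) // lerD2l ltW.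
move=> x [_ ax]; split=> [Ax|[y [_ /=]]]; last by rewrite row_mxKl.
exists 0; split; last by rewrite /= row_mxKl.
split=> // i i'; case: (split_ordP i') => [i'' ->|[]//].
by rewrite !row_mxEl; exact: ax.
Qed.

(** * Cones and the hyperplane at infinity in affine charts *)

Section Chart.
Variables (R : realType) (V : normedModType R).
Local Notation W := (V * R)%type.
Local Notation j := (@affine_embed R V).

Variables (n : nat) (b : {linear 'rV[R]_(1 + n) -> W}).

(** The map from [t] to [b (row_mx 1 t)] is affine, so half-spaces pull back to inequalities between
    an affine function, possibly constant, and a constant. *)
Lemma chart_polyhedron (Q : set W) : convex_polyhedron Q ->
  semilinear [set t | Q (b (row_mx 1 t))].
Proof.
move=> [m [H [HH ->]]].
rewrite (_ : mkset _ = [set t | forall i, H i (b (row_mx 1 t))]); last first.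
  by apply/seteqP; split=> t /= Ht i; [|move=> _]; exact: Ht.
apply: (semilinear_forall (A := fun i t => H i (b (row_mx 1 t)))) => i.
have [l [c [_ Hi]]] := HH i.
have aff : affine_fun (fun t => l (b (row_mx 1 t))).
  have [|f fE] := @affine_fun_scalar _ n (fun t => l (b (row_mx 0 t)))
    (l (b (row_mx 1 0))).
    move=> a u v; rewrite -[in row_mx _ _](scaler0 _ a) -[X in row_mx X]addr0.
    by rewrite -add_row_mx -scale_row_mx linearP /= linearP.
  exists f => t; rewrite -fE -linearD -linearD add_row_mx addr0 add0r.
  by [].
by case: Hi => ->; [exact: semilinear_lt|exact: semilinear_le].
Qed.

Lemma chart_range (P : set V) : convex_polyhedron P ->
  subanalytic (affine_chart b (j @` P)).
Proof.
move=> PP; apply: semilinear_subanalytic.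
have cone s (s0 : s != 0) := chart_polyhedron (half_cone_polyhedron s0 PP).
have := semilinearU (cone 1 (oner_neq0 _)) (cone (-1) _).
rewrite oppr_eq0 oner_eq0 => /(_ isT); congr (semilinear _).
apply/seteqP; split=> t /=; rewrite /half_cone /= mul1r mulN1r oppr_gt0.
  set w := b _ => wP.
  have w2 : w.2 != 0 by case: wP => -[w2 _]; [rewrite gt_eqF|rewrite lt_eqF].
  have w0 : w \in @punctured R V.
    by apply/mem_set; apply/eqP => w0; move: w2; rewrite w0 eqxx.
  exists (exist _ w w0) => //; exists (dehomogenize w); first by case: wP => -[].
  by apply/affine_embedE.
move=> [w <- [v Pv /affine_embedE[w2 vE]]]; rewrite -vE.
by case/orP: (lt_total w2) => ?; [right|left].
Qed.

Lemma chart_infinity : injective b ->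
  subanalytic (affine_chart b (@hyperplane_at_infinity R V)).
Proof.
move=> b_inj; apply: semilinear_subanalytic.
have := chart_polyhedron (@hyperplane_polyhedron R V); congr (semilinear _).
apply/seteqP; split=> t /=.
  move=> t2.
  (* The first coordinate of [row_mx 1 t] is 1, so injectivity of [b] keeps its image away from the
     origin. *)
  have w0 : b (row_mx 1 t) \in @punctured R V.
    apply/mem_set/eqP; rewrite -(linear0 b) => /b_inj/matrixP/(_ 0 (lshift n 0))/eqP.
    by rewrite row_mxEl !mxE eqxx oner_eq0.
  exists (exist _ (b (row_mx 1 t)) w0) => // -[v _ /affine_embedE[]].
  by rewrite /= t2 eqxx.
move=> [w <- winf]; apply: contrapT => /eqP w2; apply: winf.
by exists (dehomogenize (set_val w)) => //; apply/affine_embedE.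
Qed.
End Chart.

(** The images of the polyhedra and the hyperplane at infinity form a finite subanalytic covering,
    on each member of which [j_! F] is constant. *)
Lemma shriek_constructible (R : realType) (V : normedModType R) (k : fieldType)
    (F : Db k V) : PL F -> Rconstructible (j_shriek V k F).
Proof.
move=> [n [P [PP Pcov PF]]] m; pose j := @affine_embed R V.
pose A (o : option 'I_n) := if o is Some a then j @` P a
  else @hyperplane_at_infinity R V.
have j_cont (B : set (proj_space V)) := @set_val_continuous _ B.
exists (option 'I_n), A; split.
- by move=> x; exists setT; split; [exact: openT|by []|exact: finite_finset].
- rewrite -subTset => x _; have [[v _ vx]|xj] := pselect (range j x).
    have : setT v by []; rewrite -Pcov => -[a _ Pa].
    by exists (Some a) => //; exists v.
  by exists None.
- by move=> [a|] d b b_bij; [exact: chart_range|exact/chart_infinity/bij_inj].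
move=> o; apply: constant_locally_constant.
apply: constant_sheaf_isomorphic (cohomology_pullback _ _ _) _.
apply: constant_cohomology.
case: o => [a|].
  (* Preimages under [j] are chosen pointwise; [shriek_pullback_constant] derives the continuity of
     this choice. *)
  have H (z : A (Some a)) : exists v, P a v /\ j v = set_val z.
    by have [v Pv vz] : A (Some a) (set_val z) := set_mem (svalP z); exists v.
  have [h hP] := choice H.
  apply: (shriek_pullback_constant (h := h)) (PF a) => z; by have [] := hP z.
apply: constant_zero; apply: shriek_pullback_zero => z.
exact: set_mem (svalP z).
Qed.

(** * Affine slices *)

Section Slice.
Variables (R : realType) (V : normedModType R).
Local Notation W := (V * R)%type.
Local Notation j := (@affine_embed R V).

Definition affine_slice (Q : set W) : set V := [set v | Q (v, 1)].

(** Write [l (v, 1) = l (v, 0) + l (0, 1)]. If the first summand vanishes identically, the condition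
    does not involve [v] and the slice is empty or everything. *)
Lemma slice_half_space (H : set W) : half_space H ->
  half_space (affine_slice H) \/
  (forall v v', affine_slice H v -> affine_slice H v').
Proof.
move=> [l [c [_ HE]]].
have l1 v : l (v, 1) = l (v, 0) + l (0, 1).
  by rewrite -linearD; congr (l _); congr pair; rewrite /= ?addr0 ?add0r.
have [l0|/existsNP[v /eqP lv]] := pselect (forall v, l (v, 0) = 0).
  by right=> v v'; rewrite /affine_slice; case: HE => -> /=; rewrite (l1 v) (l1 v') !l0.
left; have lin : scalar (fun v : V => l (v, 0)).
  move=> a u u'; rewrite -linearP; congr (l _); congr pair.
  by rewrite /= scaler0 addr0.
case: HE => ->; rewrite /affine_slice /=; under eq_set do rewrite l1.
  under eq_set do rewrite -ltrBrDr; apply: half_space_lt => //; by exists v.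
under eq_set do rewrite -lerBrDr; apply: half_space_le => //; by exists v.
Qed.

(** The slice may be empty, and the empty set is not a convex polyhedron if
    [V = 0]. *)
Lemma slice_polyhedron (Q : set W) : convex_polyhedron Q ->
  affine_slice Q !=set0 -> convex_polyhedron (affine_slice Q).
Proof.
move=> [n [H [HH ->]]] [v0 Hv0].
(* Only the slices that are half-spaces are kept; the others contain [v0], hence are all of [V]. *)
pose T := {i : 'I_n | `[< half_space (affine_slice (H i)) >]}.
rewrite (_ : affine_slice _ = [set v | forall i : T, affine_slice (H (val i)) v]).
  by apply: convex_polyhedron_fin => i; exact/asboolP/(valP i).
apply/seteqP; split=> v /= Hv; first by move=> i; exact: Hv.
move=> i _; have [Hi|Hi] := slice_half_space (HH i).
  exact: (Hv (exist _ i (asboolT Hi))).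
by apply: Hi (Hv0 i I).
Qed.

Lemma affine_lift_continuous : continuous (@affine_lift R V).
Proof.
apply: subspace_continuous => v.
by apply: (@cvg_pair _ _ _ (nbhs v) (nbhs v) (nbhs (1 : R)));
  [exact: cvg_id|exact: cvg_cst].
Qed.

(** Restricting [iota_! pi^-1 G] along [v] to [(v, 1)] gives [j^-1 G], since [j] is [pi] after this
    lift. *)
Lemma PL_slice (k : fieldType) (G : Db k (proj_space V)) (j_cont : continuous j) :
  PL (shriek k (@punctured_open_embedding R V)
    (pullback k (@to_proj_continuous R V) G)) ->
  PL (pullback k j_cont G).
Proof.
move=> [n [Q [PQ Qcov QG]]].
(* Empty slices are discarded; the others still cover [V]. *)
pose T := {a : 'I_n | `[< affine_slice (Q a) !=set0 >]}.
apply: (PL_fin (P := fun a : T => affine_slice (Q (val a)))) => [a|v|a].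
- by apply: slice_polyhedron => //; exact/asboolP/(valP a).
- have : setT ((v, 1) : W) by []; rewrite -Qcov => -[a _ Qa].
  have Ha : affine_slice (Q a) !=set0 by exists v.
  by exists (exist _ a (asboolT Ha)).
set P := affine_slice _.
pose t (z : P) : @punctured R V := affine_lift (set_val z).
have t_cont : continuous t.
  move=> z; apply: continuous_comp; first exact: set_val_continuous.
  exact: affine_lift_continuous.
have c_cont : continuous (@to_proj R V \o t).
  by move=> z; apply: continuous_comp; [exact: t_cont|exact: to_proj_continuous].
have i_cont : continuous (fun z => set_val (t z)).
  by move=> z; apply: continuous_comp; [exact: t_cont|exact: set_val_continuous].
have jF := pullback_comp (@set_val_continuous _ P) j_cont c_cont G.
have tF := pullback_comp t_cont (@to_proj_continuous R V) c_cont G.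
have iF := pullback_shriek (@punctured_open_embedding R V) t_cont i_cont
  (pullback k (@to_proj_continuous R V) G) (fun=> erefl).
apply: constant_isomorphic jF _; apply: constant_isomorphic (isomorphic_sym tF) _.
apply: constant_isomorphic (isomorphic_sym iF) _.
apply: constant_restriction (QG (val a)) => z.
exact: set_mem (svalP z).
Qed.
End Slice.

(** * Extension by zero from the affine space and its essential image *)

Theorem proposition2p9 (R : realType) (k : fieldType) (V : normedModType R)
    (finV : finite_dimensional V) :
  exists wd : forall F : Db k V, PL F -> PL_proj (j_shriek V k F),
    let J : functor (DbPL k V) (DbPL_proj V k) := restrict_functor wd in
    fully_faithful J /\
    forall G : DbPL_proj V k,
      essential_image J G <-> is_zero (restriction_at_infinity V k (sval G)).
Proof.
exists (fun F PLF => conj (shriek_constructible PLF) (PL_cone PLF)) => J.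
split; first exact: restrict_fully_faithful (shriek_fully_faithful _ _).
move=> G; split=> [[F [f f_iso]]|G0].
  have FG : isomorphic (j_shriek V k (sval F)) (sval G) by exists f.
  apply: isomorphic_trans (isomorphic_sym (functor_isomorphic _ FG)) _.
  by apply: shriek_pullback_zero => z; exact: set_mem (svalP z).
pose j_emb := @affine_embed_open_embedding R V.
(* The preimage of [G] is [j^-1 G], and the counit is the isomorphism back to [G]. *)
have PLG := PL_slice (open_embedding_continuous j_emb) (svalP G).2.
have [|f f_iso] := @counit_isomorphic k _ _ _ j_emb (sval G).
  (* Outside the range of [j] the stalks of [G] are those of its restriction to infinity, so [G0]
     gives acyclicity. *)
  move=> n x xj e; pose z : @hyperplane_at_infinity R V := exist _ x (mem_set xj).
  exact: (@is_zero_acyclic _ _ _ G0 n z e).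
by exists (exist _ _ PLG), f.
Qed.
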